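(* Let $M$ be a smooth 4-dimensional manifold, $\alpha$ a pseudo-Riemannian metric on $M$, $\beta$ a one-form on $M$, and $c,m,p$ real numbers. Write $\alpha(\dot x,\dot x)=\alpha_{ab}(x)\dot x^a\dot x^b$, $\beta(\dot x)=\beta_a(x)\dot x^a$ and $s=\beta(\dot x)^2/\alpha(\dot x,\dot x)$. Suppose that $$L(x,\dot x)=\alpha(\dot x,\dot x)\,s^{-p}\,(c+m\,s)^{p+1}$$ defines a Finsler spacetime $(M,L)$, and that it is of Berwald type, i.e. that there is a function $H=H(x)$ on $M$ with $$\nabla_a\beta_b=H\left(\left[c(1-p)+m\,\alpha^{-1}(\beta,\beta)\right]\beta_a\beta_b+c\,p\,\alpha^{-1}(\beta,\beta)\,\alpha_{ab}\right),$$ where $\nabla$ is the Levi--Civita connection of $\alpha$. Let $R_{ab}$ be the Chern--Rund Ricci tensor of $(M,L)$, and let $\mathcal{A}(R)$ be its skew-symmetric part, with components $\frac12(R_{ab}-R_{ba})$. Then $$\mathcal{A}(R)=f\,\beta\wedge dH,\qquad f=\tfrac12\left(4cp-m\,\alpha^{-1}(\beta,\beta)\right),$$ i.e. $\frac12(R_{ab}-R_{ba})=f\,(\beta_a\partial_bH-\beta_b\partial_aH)$. If $f\neq0$ and $\beta\wedge dH\neq0$ (at some common point of $M$), then $(M,L)$ is non-metrizable, i.e. there is no pseudo-Riemannian metric on $M$ whose Levi--Civita connection is the affine connection of $(M,L)$.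
   Context: Let $TM$ carry the induced local coordinates $(x^a,\dot x^a)$, where $\dot x=\dot x^a\partial_a\in T_xM$. Write $\partial_a=\partial/\partial x^a$ and $\dot\partial_a=\partial/\partial\dot x^a$. Smooth means $C^\infty$. Here $\alpha^{-1}(\beta,\beta)=\alpha^{ab}\beta_a\beta_b$, and the wedge product of one-forms is normalized so that $(\beta\wedge\omega)_{ab}=\beta_a\omega_b-\beta_b\omega_a$. Conic subbundle: a non-empty open submanifold $\mathcal{Q}\subset TM\setminus\{0\}$ such that $\pi(\mathcal{Q})=M$, where $\pi:TM\to M$ is the projection, and such that $(x,\dot x)\in\mathcal{Q}$ implies $(x,\lambda\dot x)\in\mathcal{Q}$ for all $\lambda>0$. Finsler spacetime: a pair $(M,L)$, where $L:\mathcal{A}\to\mathbb{R}$ is a smooth function on a conic subbundle $\mathcal{A}\subset TM$ such that: (i) $L(x,\lambda\dot x)=\lambda^2L(x,\dot x)$ for all $\lambda>0$; (ii) on $\mathcal{A}$ the $L$-metric $g^L_{ab}=\frac12\dot\partial_a\dot\partial_bL$ is nondegenerate; (iii) there is a conic subset $\mathcal{T}\subset\mathcal{A}$ on which $L>0$ and $g^L$ has Lorentzian signature $(+,-,-,-)$, and $L$ can be continuously extended to the boundary $\partial\mathcal{T}$ by $L|_{\partial\mathcal{T}}=0$. (Equivalently, one may use the opposite sign of $L$ and signature $(-,+,+,+)$.) Geodesic spray coefficients on $\mathcal{A}$: $G^a=\frac14 (g^L)^{aq}(\dot x^m\partial_m\dot\partial_qL-\partial_qL)$. Berwald type: $(M,L)$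 is of Berwald type if $G^a(x,\dot x)=\frac12\Gamma^a{}_{bc}(x)\dot x^b\dot x^c$ with coefficients $\Gamma^a{}_{bc}(x)=\dot\partial_b\dot\partial_cG^a$ depending only on $x$. These are the coefficients of a torsion-free affine connection on $M$, called the affine connection of $(M,L)$; it is given by the Chern--Rund connection. For Lagrangians of the form $L(x,\dot x)=\alpha(\dot x,\dot x)\,s^{-p}\,(c+m\,s)^{p+1}$ with $s=\beta(\dot x)^2/\alpha(\dot x,\dot x)$, it is a previously known result that the Berwald property is equivalent to the condition $\nabla_a\beta_b=H\left(\left[c(1-p)+m\,\alpha^{-1}(\beta,\beta)\right]\beta_a\beta_b+c\,p\,\alpha^{-1}(\beta,\beta)\,\alpha_{ab}\right)$ for some function $H=H(x)$ on $M$, where $\nabla$ is the Levi--Civita connection of $\alpha$. Chern--Rund Ricci tensor of a Berwald spacetime: $R_{ab}=\partial_m\Gamma^m{}_{ab}-\partial_b\Gamma^m{}_{am}+\Gamma^m{}_{ms}\Gamma^s{}_{ab}-\Gamma^m{}_{bs}\Gamma^s{}_{am}$. *)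

(* Defs.v *)
From mathcomp Require Import all_boot all_order all_algebra.
From mathcomp Require Import all_classical all_reals all_analysis.

Set Implicit Arguments.
Unset Strict Implicit.
Unset Printing Implicit Defensive.

Import Order.TTheory GRing.Theory Num.Theory.
Import numFieldNormedType.Exports.

Local Open Scope classical_set_scope.
Local Open Scope ring_scope.

(** Geometric objects on a manifold (functions, one-forms, metrics, functions
    on the tangent bundle) are families of components, one for each chart,
    subject to the corresponding transformation law on chart overlaps.  The
    components in a chart are total functions, but only their values on the
    image of the chart are meaningful. *)

(** On an open subset of a finite-dimensional space, the existence and
    continuity of all iterated directional derivatives is the usual notion of
    smoothness. *)
Fixpoint classC (R : realType) (V W : normedModType R) (k : nat)
    (U : set V) (f : V -> W) : Prop :=
  (forall x, U x -> {for x, continuous f}) /\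
  if k is k'.+1 then
    forall v, (forall x, U x -> derivable f x v) /\
              classC k' U (fun x => 'D_v f x)
  else True.

Definition smooth (R : realType) (V W : normedModType R)
    (U : set V) (f : V -> W) : Prop := forall k, classC k U f.

Record smoothManifold (R : realType) (n : nat) := SmoothManifold {
  carrier :> topologicalType;
  chart_index : Type;
  chart_dom : chart_index -> set carrier;
  chart : chart_index -> carrier -> 'rV[R]_n;
  chart_inv : chart_index -> 'rV[R]_n -> carrier;
  carrier_hausdorff : hausdorff_space carrier;
  carrier_second_countable : @second_countable carrier;
  chart_dom_open : forall i, open (chart_dom i);
  chart_cover : forall x, exists i, chart_dom i x;
  chart_img_open : forall i, open (chart i @` chart_dom i);
  chartK : forall i x, chart_dom i x -> chart_inv i (chart i x) = x;
  chart_continuous : forall i x, chart_dom i x -> {for x, continuous (chart i)};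
  chart_inv_continuous : forall i y, (chart i @` chart_dom i) y ->
    {for y, continuous (chart_inv i)};
  transition_smooth : forall i j,
    smooth (chart i @` (chart_dom i `&` chart_dom j)) (chart j \o chart_inv i)
}.

Section Tensors.
Variables (R : realType) (n : nat) (M : smoothManifold R n).
Implicit Types (i j : chart_index M) (x : 'rV[R]_n).

Definition chart_img i : set 'rV[R]_n := @chart _ _ M i @` @chart_dom _ _ M i.

Definition overlap i j : set 'rV[R]_n :=
  @chart _ _ M i @` (@chart_dom _ _ M i `&` @chart_dom _ _ M j).

Definition transition i j : 'rV[R]_n -> 'rV[R]_n :=
  @chart _ _ M j \o @chart_inv _ _ M i.

Definition smooth_function (H : M -> R) : Prop :=
  forall i, smooth (chart_img i) (H \o @chart_inv _ _ M i).

(** With the library's row-vector convention, entry [(a, b)] of the Jacobian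
    matrix ['J f x] is the [a]-th partial derivative of the [b]-th component
    of [f]. *)
Record oneForm := OneForm {
  oneform_comp :> chart_index M -> 'rV[R]_n -> 'rV[R]_n;
  oneform_smooth : forall i a, smooth (chart_img i)
    (fun x => oneform_comp i x 0 a);
  oneform_change : forall i j x, overlap i j x ->
    oneform_comp i x =
      oneform_comp j (transition i j x) *m ('J (transition i j) x)^T
}.

Record pseudoMetric := PseudoMetric {
  metric_comp :> chart_index M -> 'rV[R]_n -> 'M[R]_n;
  metric_smooth : forall i a b, smooth (chart_img i)
    (fun x => metric_comp i x a b);
  metric_sym : forall i x, chart_img i x -> (metric_comp i x)^T = metric_comp i x;
  metric_nondegenerate : forall i x, chart_img i x -> metric_comp i x \in unitmx;
  metric_change : forall i j x, overlap i j x ->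
    metric_comp i x =
      'J (transition i j) x *m metric_comp j (transition i j x)
        *m ('J (transition i j) x)^T
}.

Definition basis_vec (a : 'I_n) : 'rV[R]_n := delta_mx 0 a.

Definition partial (a : 'I_n) (f : 'rV[R]_n -> R) (x : 'rV[R]_n) : R :=
  'D_(basis_vec a) f x.

Definition differential (H : M -> R) i x : 'rV[R]_n :=
  \row_a partial a (H \o @chart_inv _ _ M i) x.

Definition wedge (b w : 'rV[R]_n) : 'M[R]_n :=
  \matrix_(a, d) (b 0 a * w 0 d - b 0 d * w 0 a).

(** Coefficients [Gamma i x a b c] of a connection in the chart [i], where [a]
    is the upper index. *)
Definition connection_coefs :=
  chart_index M -> 'rV[R]_n -> 'I_n -> 'I_n -> 'I_n -> R.

Definition levi_civita (g : pseudoMetric) : connection_coefs :=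
  fun i x a b c =>
    2^-1 * \sum_d invmx (g i x) a d *
      (partial b (fun y => g i y d c) x + partial c (fun y => g i y b d) x
       - partial d (fun y => g i y b c) x).

(** [cov_deriv Gamma beta i x a b] is $\nabla_a \beta_b$. *)
Definition cov_deriv (Gamma : connection_coefs) (beta : oneForm) i x
    (a b : 'I_n) : R :=
  partial a (fun y => beta i y 0 b) x - \sum_d Gamma i x d a b * beta i x 0 d.

Definition ricci (Gamma : connection_coefs) i x : 'M[R]_n :=
  \matrix_(a, b)
    (\sum_m partial m (fun y => Gamma i y m a b) x
     - \sum_m partial b (fun y => Gamma i y m a m) x
     + \sum_m \sum_s Gamma i x m m s * Gamma i x s a b
     - \sum_m \sum_s Gamma i x m b s * Gamma i x s a m).

Definition skew_part (A : 'M[R]_n) : 'M[R]_n := 2^-1 *: (A - A^T).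

Definition metrizable (Gamma : connection_coefs) : Prop :=
  exists g : pseudoMetric, forall i x, chart_img i x ->
    forall a b c, levi_civita g i x a b c = Gamma i x a b c.

Definition metric_eval (alpha : pseudoMetric) i (z : 'rV[R]_n * 'rV[R]_n) : R :=
  \sum_a \sum_b alpha i z.1 a b * z.2 0 a * z.2 0 b.

Definition oneform_eval (beta : oneForm) i (z : 'rV[R]_n * 'rV[R]_n) : R :=
  \sum_a beta i z.1 0 a * z.2 0 a.

Definition dual_norm (alpha : pseudoMetric) (beta : oneForm) i x : R :=
  \sum_a \sum_b invmx (alpha i x) a b * beta i x 0 a * beta i x 0 b.

End Tensors.

Section Finsler.
Variables (R : realType) (n : nat) (M : smoothManifold R n).
Implicit Types (i j : chart_index M) (z : 'rV[R]_n * 'rV[R]_n).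

(** Tangent vectors are represented by their induced coordinates
    [z = (x, xdot)]. *)
Definition tangent_change i j z : 'rV[R]_n * 'rV[R]_n :=
  (transition i j z.1, z.2 *m 'J (transition i j) z.1).

Definition tangent_chart i : set ('rV[R]_n * 'rV[R]_n) :=
  [set z | chart_img i z.1].

Definition tangent_subset (Q : chart_index M -> set ('rV[R]_n * 'rV[R]_n)) :=
  (forall i, Q i `<=` tangent_chart i) /\
  (forall i j z, overlap i j z.1 -> (Q i z <-> Q j (tangent_change i j z))).

Definition conic (Q : chart_index M -> set ('rV[R]_n * 'rV[R]_n)) :=
  forall i z (l : R), Q i z -> 0 < l -> Q i (z.1, l *: z.2).

Definition conic_subbundle (Q : chart_index M -> set ('rV[R]_n * 'rV[R]_n)) :=
  [/\ tangent_subset Q /\ (exists i z, Q i z),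
      forall i, open (Q i),
      forall i z, Q i z -> z.2 != 0,
      forall i x, chart_img i x -> exists v, Q i (x, v)
    & conic Q].

Definition partial_pos (a : 'I_n) (F : 'rV[R]_n * 'rV[R]_n -> R) z : R :=
  'D_((basis_vec R a, 0) : 'rV[R]_n * 'rV[R]_n) F z.

Definition partial_vel (a : 'I_n) (F : 'rV[R]_n * 'rV[R]_n -> R) z : R :=
  'D_((0, basis_vec R a) : 'rV[R]_n * 'rV[R]_n) F z.

Definition L_metric (F : 'rV[R]_n * 'rV[R]_n -> R) z : 'M[R]_n :=
  \matrix_(a, b) (2^-1 * partial_vel a (partial_vel b F) z).

Definition spray (F : 'rV[R]_n * 'rV[R]_n -> R) (a : 'I_n) z : R :=
  4^-1 * \sum_q invmx (L_metric F z) a q *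
    (\sum_m z.2 0 m * partial_pos m (partial_vel q F) z - partial_pos q F z).

(** Signature (+,-,...,-). *)
Definition lorentzian (g : 'M[R]_n) : Prop :=
  exists2 P : 'M[R]_n, P \in unitmx &
    P *m g *m P^T = diag_mx (\row_a (if val a == 0%N then 1 else -1)).

(** The boundary is taken in the (coordinate patch of the) tangent bundle. *)
Definition extends_by_zero i (T : set ('rV[R]_n * 'rV[R]_n))
    (F : 'rV[R]_n * 'rV[R]_n -> R) : Prop :=
  exists Fbar : 'rV[R]_n * 'rV[R]_n -> R,
    [/\ {within closure T `&` tangent_chart i, continuous Fbar},
        forall z, T z -> Fbar z = F z
      & forall z, (closure T `\` T°) z -> tangent_chart i z -> Fbar z = 0].

Record finslerSpacetime := FinslerSpacetime {
  lag_dom : chart_index M -> set ('rV[R]_n * 'rV[R]_n);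
  lag :> chart_index M -> 'rV[R]_n * 'rV[R]_n -> R;
  lag_dom_conic : conic_subbundle lag_dom;
  lag_change : forall i j z, overlap i j z.1 -> lag_dom i z ->
    lag i z = lag j (tangent_change i j z);
  lag_smooth : forall i, smooth (lag_dom i) (lag i);
  lag_homogeneous : forall i z (l : R), lag_dom i z -> 0 < l ->
    lag i (z.1, l *: z.2) = l ^+ 2 * lag i z;
  lag_nondegenerate : forall i z, lag_dom i z -> L_metric (lag i) z \in unitmx;
  lag_timelike : exists T : chart_index M -> set ('rV[R]_n * 'rV[R]_n),
    [/\ tangent_subset T /\ conic T,
        exists i z, T i z,
        forall i, T i `<=` lag_dom i,
        forall i z, T i z -> 0 < lag i z /\ lorentzian (L_metric (lag i) z)
      & forall i, extends_by_zero i (T i) (lag i)]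
}.

(** [L] is of Berwald type if there is such a [Gamma]; the latter is then
    unique on the chart images, since every fiber of the domain of [L] is
    non-empty. *)
Definition affine_connection_of (L : finslerSpacetime)
    (Gamma : connection_coefs M) : Prop :=
  forall i z, lag_dom L i z ->
    (forall a, spray (L i) a z =
       2^-1 * \sum_b \sum_c Gamma i z.1 a b c * z.2 0 b * z.2 0 c) /\
    (forall a b c, Gamma i z.1 a b c =
       partial_vel b (partial_vel c (spray (L i) a)) z).

(** [real_power y r u]: the power [y ^ r] is defined, with value [u].  It is
    defined for positive [y], and for any [y] if [r] is an integer (nonnegative
    if [y = 0]). *)
Definition real_power (y r u : R) : Prop :=
  (0 < y /\ u = y `^ r) \/
  (exists k : int, [/\ r = k%:~R, y != 0 \/ 0 <= k & u = y ^ k]).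

(** [L] is given by $\alpha(\dot x,\dot x) s^{-p} (c + m s)^{p+1}$ on its
    domain, all terms of this expression being defined there. *)
Definition has_lagrangian (alpha : pseudoMetric M) (beta : oneForm M)
    (c m p : R) (L : finslerSpacetime) : Prop :=
  forall i z, lag_dom L i z ->
    let A := metric_eval alpha i z in
    let s := oneform_eval beta i z ^+ 2 / A in
    A != 0 /\
    exists u w : R, [/\ real_power s (- p) u, real_power (c + m * s) (p + 1) w
      & L i z = A * u * w].

Definition berwald_condition (alpha : pseudoMetric M) (beta : oneForm M)
    (c m p : R) (H : M -> R) : Prop :=
  forall i x, chart_img i x -> forall a b : 'I_n,
    cov_deriv (levi_civita alpha) beta i x a b =
    H (chart_inv i x) *
      ((c * (1 - p) + m * dual_norm alpha beta i x) * beta i x 0 a * beta i x 0 b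
       + c * p * dual_norm alpha beta i x * alpha i x a b).

End Finsler.

(* Main.v *)
Require Import Defs.
From mathcomp Require Import all_boot all_order all_algebra.
From mathcomp Require Import ring lra.
From mathcomp Require Import all_classical all_reals all_analysis.
Set Implicit Arguments.
Unset Strict Implicit.
Unset Printing Implicit Defensive.
Import Order.TTheory GRing.Theory Num.Theory.
Import numFieldNormedType.Exports.
Local Open Scope classical_set_scope.
Local Open Scope ring_scope.

(** The Berwald condition makes the torsion-free connection
    [Gamma = LC + H D], with
    [D^a_bc = c p beta^a alpha_bc - c p (delta^a_b beta_c + delta^a_c beta_b)
              + m beta^a beta_b beta_c],
    parallel for [L]: with [B = beta(v)] and [Q = c alpha(v,v) + m B^2], the
    derivatives along the horizontal lift of [d_a] are
    [(1 + p) c H beta_a B] and [2 p c H beta_a Q], so that they cancel in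
    [ln L^2 = -2p ln B^2 + (p + 1) ln Q^2].  Hence [Gamma] is the affine
    connection of [L].  The skew part of its Ricci tensor is half the curl of
    the trace [Gamma^m_am], which is a closed form (the trace for
    Levi-Civita) plus [H (m |beta|^2 - n c p) beta_a].  By the Berwald
    condition [beta] is closed and [d |beta|^2] is proportional to [beta], so
    only [dH] contributes to the curl. *)

(** * Rules for directional derivatives *)

Section DirectionalDerivatives.
Context {R : realType} {V : normedModType R}.
Implicit Types (f g : V -> R) (x y u v : V).

Lemma is_derive_addf f g x v df dg :
  is_derive x v f df -> is_derive x v g dg ->
  is_derive x v (fun y => f y + g y) (df + dg).
Proof. exact: is_deriveD. Qed.

Lemma is_derive_oppf f x v df :
  is_derive x v f df -> is_derive x v (fun y => - f y) (- df).
Proof. exact: is_deriveN. Qed.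

Lemma is_derive_mulf f g x v df dg :
  is_derive x v f df -> is_derive x v g dg ->
  is_derive x v (fun y => f y * g y) (df * g x + f x * dg).
Proof.
move=> hf hg; apply: (is_derive_eq _ (df := df * g x + f x * dg)).
by rewrite addrC [df * _]mulrC.
Qed.

Lemma is_derive_cstf (k : R) x v : is_derive x v (fun=> k) 0.
Proof. exact: is_derive_cst. Qed.

Lemma is_derive_scalef f x v (k df : R) :
  is_derive x v f df -> is_derive x v (fun y => k * f y) (k * df).
Proof. exact: is_deriveZ. Qed.

Lemma is_derive_sumf (I : finType) (h : I -> V -> R) x v (dh : I -> R) :
  (forall i, is_derive x v (h i) (dh i)) ->
  is_derive x v (fun y => \sum_i h i y) (\sum_i dh i).
Proof.
move=> hd; rewrite -fct_sumE; elim/big_ind2 : _ => // [|f1 d1 f2 d2].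
  exact: is_derive_cst.
exact: is_deriveD.
Qed.

(** The two difference quotients coincide. Together with the converse at [t = 0] below, this moves
    questions about directional derivatives to one real variable, where the chain rule and the mean
    value theorem apply. *)
Lemma is_derive_line {W : normedModType R} (f : V -> W) x v df (t : R) :
  is_derive (x + t *: v) v f df -> is_derive t 1 (fun s : R => f (x + s *: v)) df.
Proof.
case; rewrite /derivable /derive /= => h1 h2.
have E : (fun h : R => h^-1 *: (((fun s : R => f (x + s *: v)) \o shift t) (h *: 1)
   - f (x + t *: v))) = (fun h : R => h^-1 *: ((f \o shift (x + t *: v)) (h *: v)
   - f (x + t *: v))).
  by apply/funext => h /=; rewrite [h%:A]mulr1 scalerDl addrCA.
by split; rewrite /derivable /derive /= E.
Qed.

Lemma is_derive_at_line f x v df :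
  is_derive (0 : R) 1 (fun s : R => f (x + s *: v)) df -> is_derive x v f df.
Proof.
case; rewrite /derivable /derive.
have -> : (fun h : R => h^-1 *: (((fun s : R => f (x + s *: v)) \o shift 0) (h *: 1)
   - f (x + 0 *: v))) = (fun h : R => h^-1 *: ((f \o shift x) (h *: v) - f x)).
  by apply/funext => h /=; rewrite [h%:A]mulr1 scale0r !addr0 [x + _]addrC.
by split.
Qed.

(** The chain rule is applied on the line through [x] in direction [v], so [f] only has to be
    derivable in that one direction. *)
Lemma is_derive_compf (phi : R -> R) f x v df dphi :
  is_derive x v f df -> is_derive (f x) 1 phi dphi ->
  is_derive x v (fun y => phi (f y)) (dphi * df).
Proof.
move=> hf hphi.
have {}hf : is_derive (0 : R) 1 (fun s : R => f (x + s *: v)) df.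
  by apply: is_derive_line; rewrite scale0r addr0.
apply: is_derive_at_line; split.
  apply/derivable1_diffP/differentiable_comp; apply/derivable1_diffP => //=.
  by rewrite scale0r addr0.
rewrite -derive1E (@derive1_comp _ (fun s : R => f (x + s *: v)) phi) //=.
  by rewrite !derive1E scale0r addr0 !derive_val.
by rewrite scale0r addr0.
Qed.

End DirectionalDerivatives.

(** * Mean values along segments *)

Section MeanValue.
Context {R : realType} {V : normedModType R}.
Implicit Types (f g : V -> R) (x y u v : V).

(** The line is reparametrized by [s -> k * s], which treats all [k] at once, including [k = 0]. *)
Lemma derive_scale_dir f x v (k : R) :
  derivable f x v -> is_derive x (k *: v) f (k * 'D_v f x).
Proof.
move=> hf.
have hk : is_derive (0 : R) 1 (fun s : R => k * s) (k * 1).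
  exact: is_derive_scalef (is_derive_id _ _).
have hl : is_derive (k * 0) 1 (fun s : R => f (x + s *: v)) ('D_v f x).
  by apply: is_derive_line; rewrite mulr0 scale0r addr0; exact: derivableP.
apply: is_derive_at_line.
have := is_derive_compf hk hl.
rewrite mulr1 [_ * k]mulrC.
rewrite (_ : (fun s : R => f (x + s *: (k *: v))) =
  (fun s : R => f (x + (k * s) *: v))) //.
by apply/funext => s; rewrite scalerA mulrC.
Qed.

Lemma segment_mean_value f x v (d : R) : 0 < d ->
  (forall s, 0 <= s <= d -> derivable f (x + s *: v) v) ->
  exists2 s, 0 <= s <= d & f (x + d *: v) - f x = d * 'D_v f (x + s *: v).
Proof.
move=> d0 hf.
have hl s : 0 <= s <= d ->
    is_derive s 1 (fun s : R => f (x + s *: v)) ('D_v f (x + s *: v)).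
  by move=> /hf /derivableP; exact: is_derive_line.
have [||s] := @MVT R (fun s : R => f (x + s *: v))
    (fun s => 'D_v f (x + s *: v)) 0 d d0.
- by move=> s; rewrite in_itv /= => /andP[s0 sd]; apply: hl; rewrite !ltW.
- apply: derivable_within_continuous => s; rewrite in_itv /= => hs.
  by case: (hl _ hs).
rewrite in_itv /= => /andP[s0 sd] E; exists s; first by rewrite !ltW.
by move: E; rewrite scale0r addr0 subr0 mulrC.
Qed.

(** By continuity of [(s, t) -> x + s u + t v] at the origin. It provides a single step [d] for
    which the intermediate points of the mean value arguments below all satisfy [P]. *)
Lemma near_parallelogram (P : set V) x u v : nbhs x P ->
  exists2 d : R, 0 < d & forall s t, 0 <= s <= d -> 0 <= t <= d ->
    P (x + s *: u + t *: v).
Proof.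
move=> Px.
have hc : (fun z : R * R => x + z.1 *: u + z.2 *: v) @ (0 : R, 0 : R) --> x.
  rewrite -[X in _ --> X](_ : x + (0 : R) *: u + (0 : R) *: v = _); last first.
    by rewrite !scale0r !addr0.
  apply: cvgD; first apply: cvgD; first exact: cvg_cst.
  - by apply: cvgZr_tmp; exact: cvg_fst.
  - by apply: cvgZr_tmp; exact: cvg_snd.
have [[A B] /= [[d1 /= d10 hA] [d2 /= d20 hB]] hAB] := hc _ Px.
(* Half the smaller radius puts parameters up to and including [d] strictly inside both balls. *)
exists (Num.min d1 d2 / 2); first by rewrite divr_gt0 // lt_min d10.
have bound s : 0 <= s <= Num.min d1 d2 / 2 -> `|0 - s| < Num.min d1 d2.
  have : 0 < Num.min d1 d2 by rewrite lt_min d10.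
  by move=> m0 /andP[s0 se]; rewrite sub0r normrN ger0_norm //; lra.
move=> s t /bound + /bound; rewrite !lt_min => /andP[hs _] /andP[_ ht].
by apply: (hAB (s, t)); split; [exact: hA|exact: hB].
Qed.

End MeanValue.

(** * Linearity in the direction and symmetry of second derivatives *)

Lemma dist_add_close {R : realFieldType} (a b c a' b' c' e : R) :
  c' = a' + b' -> `|a' - a| < e / 3 -> `|b' - b| < e / 3 -> `|c' - c| < e / 3 ->
  `|c - (a + b)| <= e.
Proof.
move=> ->; rewrite !ltr_norml ler_norml => /andP[? ?] /andP[? ?] /andP[? ?].
by apply/andP; split; lra.
Qed.

Lemma dist_close {R : realFieldType} (a b c e : R) :
  `|c - a| < e / 2 -> `|c - b| < e / 2 -> `|b - a| <= e.
Proof.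
rewrite !ltr_norml ler_norml => /andP[? ?] /andP[? ?].
by apply/andP; split; lra.
Qed.

Section ClassC.
Context {R : realType} {V : normedModType R}.
Implicit Types (f : V -> R) (x y u v : V) (U : set V).

Lemma classC_derivable k U f x v : classC k.+1 U f -> U x -> derivable f x v.
Proof. by case=> _ /(_ v)[] /(_ x). Qed.

Lemma classC_derive k U f v : classC k.+1 U f -> classC k U ('D_v f).
Proof. by case=> _ /(_ v)[]. Qed.

Lemma classC_continuous k U f x : classC k U f -> U x -> {for x, continuous f}.
Proof. by case: k => [|k] [hf _] /hf. Qed.

Lemma smooth_derivable U f x v : smooth U f -> U x -> derivable f x v.
Proof. by move=> /(_ 1%N) hf; exact: classC_derivable hf. Qed.

Lemma smooth_derive U f v : smooth U f -> smooth U ('D_v f).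
Proof. by move=> hf k; exact: classC_derive (hf k.+1). Qed.

Lemma classC_sub k U U' f : U' `<=` U -> classC k U f -> classC k U' f.
Proof.
move=> sub; elim: k f => [|k IHk] f [hc hd].
  by split=> // x /sub /hc.
split=> [x /sub /hc //|v]; have [h1 h2] := hd v; split=> [x /sub /h1|] //; exact: IHk.
Qed.

Lemma continuous_near_dist f x (e : R) : {for x, continuous f} -> 0 < e ->
  \forall y \near x, `|f y - f x| < e.
Proof.
move=> hc e0; have /cvgrPdist_lt /(_ _ e0) := hc.
by apply: filterS => y; rewrite distrC.
Qed.

(** The increment of [f] along [d (u + v)] is the sum of the increments along the legs [d v] and
    then [d u]. The mean value theorem on the diagonal and on each leg gives the identity exactly at
    three intermediate points, and continuity of the three derivatives brings it to [x] up to any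
    [e]. *)
Lemma derive_add_dir U f x u v : open U -> classC 1 U f -> U x ->
  'D_(u + v) f x = 'D_u f x + 'D_v f x.
Proof.
move=> oU hf Ux; apply/eqP; rewrite -subr_eq0 -normr_le0.
apply/ler_addgt0Pl => e e0; rewrite addr0.
have e3 : 0 < e / 3 by rewrite divr_gt0.
have near_dir w : \forall y \near x, `|'D_w f y - 'D_w f x| < e / 3.
  apply: continuous_near_dist => //.
  exact: (classC_continuous (classC_derive w hf) Ux).
have nP : \forall y \near x, [/\ U y, `|'D_u f y - 'D_u f x| < e / 3,
    `|'D_v f y - 'D_v f x| < e / 3 & `|'D_(u + v) f y - 'D_(u + v) f x| < e / 3].
  apply: filterS (filterI (open_nbhs_nbhs (conj oU Ux)) (filterI (near_dir u)
    (filterI (near_dir v) (near_dir (u + v))))) => y [? [? [? ?]]].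
  by split.
have [d d0 hd] := near_parallelogram u v nP.
have d0d : 0 <= d <= d by rewrite lexx ltW.
have z0d : 0 <= (0 : R) <= d by rewrite lexx ltW.
have [s hs Es] : exists2 s, 0 <= s <= d &
    f (x + d *: v + d *: u) - f (x + d *: v) = d * 'D_u f (x + d *: v + s *: u).
  apply: segment_mean_value => // s hs; apply: (classC_derivable hf).
  by rewrite addrAC; have [] := hd s d hs d0d.
have [t ht Et] : exists2 t, 0 <= t <= d &
    f (x + d *: v) - f x = d * 'D_v f (x + t *: v).
  apply: segment_mean_value => // s' hs'; apply: (classC_derivable hf).
  by have [] := hd 0 s' z0d hs'; rewrite scale0r addr0.
have [r hr Er] : exists2 r, 0 <= r <= d &
    f (x + d *: (u + v)) - f x = d * 'D_(u + v) f (x + r *: (u + v)).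
  apply: segment_mean_value => // s' hs'; apply: (classC_derivable hf).
  by have [] := hd s' s' hs' hs'; rewrite scalerDr addrA.
have [_ hu _ _] := hd s d hs d0d.
have [_ _ hv _] := hd 0 t z0d ht; rewrite scale0r addr0 in hv.
have [_ _ _ huv] := hd r r hr hr.
rewrite -addrA -scalerDr in huv; rewrite addrAC in hu.
have E : 'D_(u + v) f (x + r *: (u + v)) =
    'D_u f (x + d *: v + s *: u) + 'D_v f (x + t *: v).
  apply: (mulfI (lt0r_neq0 d0)); rewrite mulrDr -Es -Et -Er.
  by rewrite addrA subrK scalerDr addrA [x + _ + _]addrAC.
exact: dist_add_close E hu hv huv.
Qed.

Lemma derive_sum_dir U f x u (I : finType) (k : I -> R) (w : I -> V) :
  open U -> classC 1 U f -> U x ->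
  'D_(u + \sum_i k i *: w i) f x = 'D_u f x + \sum_i k i * 'D_(w i) f x.
Proof.
move=> oU hf Ux; rewrite (derive_add_dir u _ oU hf Ux); congr (_ + _).
elim/big_ind2 : _ => [|_ w1 _ w2 <- <-|i _]; first exact: derive0.
  exact: (derive_add_dir w1 w2 oU hf Ux).
by have [_ ->] := @derive_scale_dir _ _ f x (w i) (k i) (classC_derivable hf Ux).
Qed.

(** Two mean value theorems: along [u] for the difference [g] of [f] across [d v], then along [v]
    for ['D_u f]. *)
Lemma mixed_difference f x u v (d : R) : 0 < d ->
  (forall s t, 0 <= s <= d -> 0 <= t <= d ->
     derivable f (x + s *: u + t *: v) u /\
     derivable ('D_u f) (x + s *: u + t *: v) v) ->
  exists s t, [/\ 0 <= s <= d, 0 <= t <= d &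
    f (x + d *: u + d *: v) - f (x + d *: u) - (f (x + d *: v) - f x) =
    d * (d * 'D_v ('D_u f) (x + s *: u + t *: v))].
Proof.
move=> d0 hd; have d0d : 0 <= d <= d by rewrite lexx ltW.
have z0d : 0 <= (0 : R) <= d by rewrite lexx ltW.
pose g y := f (y + d *: v) - f y.
have dg s : 0 <= s <= d -> is_derive (x + s *: u) u g
    ('D_u f (x + s *: u + d *: v) - 'D_u f (x + s *: u)).
  move=> hs; apply: is_derive_addf.
    have [h _] := hd _ _ hs d0d.
    apply: is_derive_at_line.
    have := derivableP h; rewrite -[x + s *: u + d *: v]addr0 -(scale0r u).
    move=> /is_derive_line; rewrite scale0r addr0.
    rewrite (_ : (fun s0 : R => f (x + s *: u + s0 *: u + d *: v)) =
      (fun s0 : R => f (x + s *: u + d *: v + s0 *: u))) //.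
    by apply/funext => r; rewrite addrAC.
  apply: is_derive_oppf; apply: derivableP.
  by have [h _] := hd _ _ hs z0d; rewrite scale0r addr0 in h.
have [s hs Es] := @segment_mean_value _ _ g x u d d0 (fun s hs => let: DeriveDef h _ := dg s hs in h).
rewrite (let: DeriveDef _ h := dg s hs in h) in Es.
have [t ht Et] := @segment_mean_value _ _ ('D_u f) (x + s *: u) v d d0
   (fun t ht => (hd s t hs ht).2).
by exists s, t; split => //; rewrite -Et -Es.
Qed.

(** Schwarz's theorem. The second difference over a parallelogram is symmetric in [u] and [v], so
    each mixed derivative takes the same value at some point of the parallelogram; both are
    continuous at [x]. *)
Lemma derive_comm U f x u v : open U -> classC 2 U f -> U x ->
  'D_u ('D_v f) x = 'D_v ('D_u f) x.
Proof.
move=> oU hf Ux; apply/eqP; rewrite -subr_eq0 -normr_le0.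
apply/ler_addgt0Pl => e e0; rewrite addr0.
have e2 : 0 < e / 2 by rewrite divr_gt0.
have near_dir w w' :
    \forall y \near x, `|'D_w ('D_w' f) y - 'D_w ('D_w' f) x| < e / 2.
  apply: continuous_near_dist => //.
  exact: (classC_continuous (classC_derive w (classC_derive w' hf)) Ux).
have nP : \forall y \near x, [/\ U y,
    `|'D_u ('D_v f) y - 'D_u ('D_v f) x| < e / 2 &
    `|'D_v ('D_u f) y - 'D_v ('D_u f) x| < e / 2].
  apply: filterS (filterI (open_nbhs_nbhs (conj oU Ux))
    (filterI (near_dir u v) (near_dir v u))) => y [? [? ?]].
  by split.
have [d d0 hd] := near_parallelogram u v nP.
have [s [t [hs ht Est]]] : exists s t, [/\ 0 <= s <= d, 0 <= t <= d &
    f (x + d *: u + d *: v) - f (x + d *: u) - (f (x + d *: v) - f x) =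
    d * (d * 'D_v ('D_u f) (x + s *: u + t *: v))].
  apply: mixed_difference => // s t hs ht; have [Uy _ _] := hd s t hs ht.
  split; first exact: classC_derivable hf Uy.
  exact: classC_derivable (classC_derive u hf) Uy.
have [s' [t' [hs' ht' Est']]] : exists s t, [/\ 0 <= s <= d, 0 <= t <= d &
    f (x + d *: v + d *: u) - f (x + d *: v) - (f (x + d *: u) - f x) =
    d * (d * 'D_u ('D_v f) (x + s *: v + t *: u))].
  apply: mixed_difference => // s' t' hs' ht'.
  have [Uy _ _] := hd t' s' ht' hs'; rewrite addrAC in Uy.
  split; first exact: classC_derivable hf Uy.
  exact: classC_derivable (classC_derive v hf) Uy.
have [_ _ h1] := hd s t hs ht.
have [_ h2 _] := hd t' s' ht' hs'; rewrite addrAC in h2.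
have E : 'D_v ('D_u f) (x + s *: u + t *: v) = 'D_u ('D_v f) (x + s' *: v + t' *: u).
  apply: (mulfI (lt0r_neq0 d0)); apply: (mulfI (lt0r_neq0 d0)).
  have Exy : x + d *: v + d *: u = x + d *: u + d *: v by exact: addrAC.
  rewrite Exy in Est'; apply: etrans (esym Est) (etrans _ Est').
  by set A := f _; set B := f _; set C := f _; set D := f _; ring.
move: h1 h2; rewrite E; exact: dist_close.
Qed.

End ClassC.

(** * Derivatives of determinants and inverse matrices *)

Section MatrixDerivatives.
Context {R : realType} {V : normedModType R}.
Implicit Types (x v : V).

Lemma derivable_sumf (I : finType) (h : I -> V -> R) x v :
  (forall i, derivable (h i) x v) -> derivable (fun y => \sum_i h i y) x v.
Proof.
move=> hd; have hd' i : is_derive x v (h i) ('D_v (h i) x) by exact/derivableP/hd.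
by have [] := is_derive_sumf hd'.
Qed.

Lemma derivable_mulf (f g : V -> R) x v :
  derivable f x v -> derivable g x v -> derivable (fun y => f y * g y) x v.
Proof. exact: derivableM. Qed.

Lemma derivable_prodf (I : finType) (h : I -> V -> R) x v :
  (forall i, derivable (h i) x v) -> derivable (fun y => \prod_i h i y) x v.
Proof.
move=> hd; rewrite -fct_prodE.
apply: (big_ind (fun f => derivable f x v)) => [||i _]; last exact: hd.
  exact: (@derivable_cst R V R 1).
move=> f1 f2 h1 h2; exact: derivableM h1 h2.
Qed.

Lemma derivable_det n (A : V -> 'M[R]_n) x v :
  (forall a b, derivable (fun y => A y a b) x v) ->
  derivable (fun y => \det (A y)) x v.
Proof.
move=> hA; apply: derivable_sumf => s; apply: derivable_mulf.
  exact: derivable_cst.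
by apply: derivable_prodf => a; exact: hA.
Qed.

(** Near [x], Cramer's formula writes the entry as a cofactor divided by the determinant. *)
Lemma derivable_invmx n (A : V -> 'M[R]_n) x v a b :
  (\forall y \near x, A y \in unitmx) ->
  (forall a b, derivable (fun y => A y a b) x v) ->
  derivable (fun y => invmx (A y) a b) x v.
Proof.
move=> Aunit hA.
apply: (@near_eq_derivable _ _ _ (fun y => (\det (A y))^-1 * cofactor (A y) b a)).
  by near=> y; rewrite /invmx (near Aunit y) // !mxE.
apply: derivable_mulf.
  apply: derivableV; last exact: derivable_det.
  by rewrite -unitfE; exact: (nbhs_singleton Aunit).
apply: derivable_mulf; first exact: derivable_cst.
apply: derivable_det => c d.
rewrite (_ : (fun y => _) = fun y => A y (lift b c) (lift a d)) //.
by apply/funext => y; rewrite !mxE.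
Unshelve. all: by end_near. Qed.

(** The product of [invmx (A y)] and [A y] is constant near [x]; the product rule is then solved for
    the derivative of the first factor. *)
Lemma derive_invmx n (A : V -> 'M[R]_n) x v :
  (\forall y \near x, A y \in unitmx) ->
  (forall a b, derivable (fun y => A y a b) x v) ->
  (\matrix_(a, b) 'D_v (fun y => invmx (A y) a b) x) =
  - (invmx (A x) *m (\matrix_(a, b) 'D_v (fun y => A y a b) x) *m invmx (A x)).
Proof.
move=> Aunit hA; have Ax := nbhs_singleton Aunit.
set dI := (\matrix_(a, b) 'D_v (fun y => invmx (A y) a b) x).
set dA := (\matrix_(a, b) 'D_v (fun y => A y a b) x).
suff E : dI *m A x = - (invmx (A x) *m dA) by rewrite -mulNmx -E mulmxK.
apply/eqP; rewrite -addr_eq0; apply/eqP/matrixP => a b.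
have hd : is_derive x v (fun y => \sum_k invmx (A y) a k * A y k b)
    (\sum_k (dI a k * A x k b + invmx (A x) a k * dA k b)).
  apply: is_derive_sumf => k; rewrite !mxE; apply: is_derive_mulf.
    exact/derivableP/derivable_invmx.
  exact/derivableP.
have near1 : {near x, (fun y => \sum_k invmx (A y) a k * A y k b) =1
    cst ((1%:M : 'M[R]_n) a b)}.
  by near=> y; rewrite /= -(mulVmx (near Aunit y _)) // mxE.
have := near_eq_derive v near1; rewrite derive_cst (let: DeriveDef _ h := hd in h).
by move=> E; rewrite !mxE -big_split.
Unshelve. all: by end_near. Qed.

End MatrixDerivatives.

Lemma mxtrace_mul_swap {R : comNzRingType} n (A B C : 'M[R]_n) :
  \tr (A *m B *m A *m C) = \tr (A *m C *m A *m B).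
Proof. by rewrite -mulmxA mxtrace_mulC mulmxA. Qed.

(** * The Levi-Civita connection and its trace *)

Section LeviCivita.
Context {R : realType} {n : nat} (M : smoothManifold R n) (alpha : pseudoMetric M).
Variables (i : chart_index M).
Implicit Types (x : 'rV[R]_n) (a b c d : 'I_n).

Let U := chart_img i.
Let g := alpha i.
Let G (y : 'rV[R]_n) := invmx (g y).

Lemma chart_imgP x : U x -> \forall y \near x, U y.
Proof. by move=> Ux; apply: open_nbhs_nbhs; split => //; exact: chart_img_open. Qed.

Lemma metric_near_unit x : U x -> \forall y \near x, g y \in unitmx.
Proof. by move=> /chart_imgP; apply: filterS => y; exact: metric_nondegenerate. Qed.

Lemma metric_entry_sym x a b : U x -> g x a b = g x b a.
Proof. by move=> Ux; have /matrixP /(_ b a) := Defs.metric_sym alpha Ux; rewrite mxE. Qed.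

Lemma inverse_metric_sym x a b : U x -> G x a b = G x b a.
Proof.
move=> Ux; have := trmx_inv (alpha i x); rewrite (Defs.metric_sym alpha Ux).
by move=> /matrixP /(_ b a); rewrite mxE.
Qed.


Lemma inverse_metric_mul x a b : U x -> \sum_d G x a d * g x d b = (a == b)%:R.
Proof.
move=> Ux; have := mulVmx (metric_nondegenerate alpha Ux).
by move=> /matrixP /(_ a b); rewrite !mxE.
Qed.

Lemma partial_metric_sym x a b c : U x ->
  partial a (fun y => g y b c) x = partial a (fun y => g y c b) x.
Proof.
move=> Ux; apply: near_eq_derive; apply: filterS (chart_imgP Ux) => y Uy.
exact: metric_entry_sym.
Qed.

Lemma levi_civita_sym x a b c : U x ->
  levi_civita alpha i x a b c = levi_civita alpha i x a c b.
Proof.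
move=> Ux; congr (_ * _); apply: eq_bigr => d _; congr (_ * _).
rewrite (partial_metric_sym d c b Ux) (partial_metric_sym b d c Ux).
by rewrite (partial_metric_sym c b d Ux); ring.
Qed.

Lemma derivable_metric x v a b : U x -> derivable (fun y => g y a b) x v.
Proof. by move=> Ux; exact: smooth_derivable (metric_smooth alpha i a b) Ux. Qed.

Lemma derivable_inverse_metric x v a b : U x -> derivable (fun y => G y a b) x v.
Proof.
move=> Ux; apply: derivable_invmx; first exact: metric_near_unit.
by move=> c d; exact: derivable_metric.
Qed.

Lemma derivable_partial_metric x v a b c : U x ->
  derivable (partial c (fun y => g y a b)) x v.
Proof.
move=> Ux; apply: (@smooth_derivable _ _ U) => //.
exact/smooth_derive/metric_smooth.
Qed.

Lemma derivable_levi_civita x v a b c : U x ->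
  derivable (fun y => levi_civita alpha i y a b c) x v.
Proof.
move=> Ux; apply: derivable_mulf; first exact: derivable_cst.
apply: derivable_sumf => d; apply: derivable_mulf.
  exact: derivable_inverse_metric.
apply: derivableB; last exact: derivable_partial_metric.
by apply: derivableD; exact: derivable_partial_metric.
Qed.

(** The other two derivative terms of the Christoffel symbol are together antisymmetric in [m] and
    [d], so they vanish against the symmetric inverse metric. *)
Lemma levi_civita_trace x a : U x ->
  \sum_m levi_civita alpha i x m a m =
  2^-1 * \sum_m \sum_d G x m d * partial a (fun y => g y d m) x.
Proof.
move=> Ux; rewrite -mulr_sumr; congr (_ * _).
under eq_bigr do (under eq_bigr do rewrite -addrA mulrDr; rewrite big_split /=).
rewrite big_split /= -[RHS]addr0; congr (_ + _).
under eq_bigr do (under eq_bigr do rewrite mulrBr; rewrite sumrB).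
rewrite sumrB; apply/eqP; rewrite subr_eq0; apply/eqP; rewrite exchange_big /=.
by apply: eq_bigr => b _; apply: eq_bigr => d _; rewrite /= (inverse_metric_sym _ _ Ux).
Qed.

(** The trace is the differential of half the logarithm of the absolute value of the determinant of
    the metric. Closedness is checked without this potential: the derivative is a trace term [T],
    symmetric by cyclicity, plus a term [S] in second derivatives of the metric, symmetric by
    Schwarz. *)
Lemma levi_civita_trace_closed x a b : U x ->
  partial b (fun y => \sum_m levi_civita alpha i y m a m) x =
  partial a (fun y => \sum_m levi_civita alpha i y m b m) x.
Proof.
move=> Ux.
pose dg a := \matrix_(d, e) partial a (fun y => g y d e) x.
pose dG a := \matrix_(d, e) partial a (fun y => G y d e) x.
pose T a b := \tr (G x *m dg b *m G x *m dg a).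
pose S a b := \sum_m \sum_d G x m d * partial b (partial a (fun y => g y d m)) x.
have hd a' b' : partial b' (fun y => \sum_m levi_civita alpha i y m a' m) x =
    2^-1 * (- T a' b' + S a' b').
  have -> : partial b' (fun y => \sum_m levi_civita alpha i y m a' m) x =
      partial b' (fun y => 2^-1 * \sum_m \sum_d G y m d * partial a' (fun z => g z d m) y) x.
    apply: near_eq_derive; apply: filterS (chart_imgP Ux) => y Uy.
    exact: levi_civita_trace.
  have hG : dG b' = - (G x *m dg b' *m G x).
    apply: derive_invmx => [|c d]; first exact: metric_near_unit.
    exact: derivable_metric.
  have -> : - T a' b' = \tr (dG b' *m dg a').
    by rewrite /T hG !mulNmx [RHS]linearN.
  have : is_derive x (basis_vec R b')
      (fun y => 2^-1 * \sum_m \sum_d G y m d * partial a' (fun z => g z d m) y)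
      (2^-1 * \sum_m \sum_d (partial b' (fun y => G y m d) x * partial a' (fun z => g z d m) x
         + G x m d * partial b' (partial a' (fun y => g y d m)) x)).
    apply: is_derive_scalef; apply: is_derive_sumf => c; apply: is_derive_sumf => d.
    apply: is_derive_mulf; apply: derivableP; first exact: derivable_inverse_metric.
    exact: derivable_partial_metric.
  case=> _ E; rewrite [LHS]E; congr (_ * _).
  under eq_bigr do rewrite big_split /=.
  rewrite big_split /=; congr (_ + _).
  apply: eq_bigr => c _; rewrite mxE; apply: eq_bigr => d _.
  by rewrite !mxE.
have TC : T a b = T b a by exact: mxtrace_mul_swap.
have SC : S a b = S b a.
  apply: eq_bigr => c _; apply: eq_bigr => d _; apply: (congr1 ( *%R (G x c d))).
  apply: (@derive_comm _ _ U); first exact: chart_img_open.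
    exact: metric_smooth.
  exact: Ux.
by apply: etrans (hd a b) (etrans _ (esym (hd b a))); rewrite TC SC.
Qed.

(** Metric compatibility contracted twice with [w]: after lowering the upper index, two of the three
    derivative terms cancel by antisymmetry. It is used with [w] the raised one-form and with [w]
    the velocity. *)
Lemma levi_civita_quadratic x a (w : 'I_n -> R) : U x ->
  \sum_c w c * (\sum_d levi_civita alpha i x d a c * \sum_e g x d e * w e) =
  2^-1 * \sum_c \sum_d w c * w d * partial a (fun y => g y c d) x.
Proof.
move=> Ux.
pose S k l e := partial k (fun y => g y l e) x.
have inv e : \sum_d G x d e * (\sum_k g x d k * w k) = w e.
  under eq_bigr do rewrite mulr_sumr.
  rewrite exchange_big /=.
  transitivity (\sum_k (e == k)%:R * w k).
    apply: eq_bigr => k _; rewrite -(inverse_metric_mul e k Ux) mulr_suml.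
    by apply: eq_bigr => d _; rewrite mulrA (inverse_metric_sym _ _ Ux).
  rewrite (bigD1 e) //= eqxx mul1r big1 ?addr0 // => k.
  by rewrite eq_sym => /negPf ->; rewrite mul0r.
have low c : \sum_d levi_civita alpha i x d a c * (\sum_e g x d e * w e) =
    2^-1 * \sum_e w e * (S a e c + S c a e - S e a c).
  rewrite mulr_sumr.
  under eq_bigr => d _ do rewrite /levi_civita -mulrA mulr_suml mulr_sumr.
  rewrite exchange_big /=; apply: eq_bigr => e _.
  rewrite -mulr_sumr; congr (_ * _); rewrite -[in RHS]inv mulr_suml.
  by apply: eq_bigr => d _; rewrite mulrAC.
under eq_bigr => c _ do rewrite low mulrCA mulr_sumr.
rewrite -mulr_sumr; congr (_ * _).
transitivity (\sum_c \sum_d (w c * w d * S a c d +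
    (w c * w d * S c a d - w d * w c * S d a c))).
  apply: eq_bigr => c _; apply: eq_bigr => d _.
  by rewrite /S (partial_metric_sym a d c Ux); ring.
under eq_bigr => c _ do rewrite big_split sumrB.
rewrite big_split sumrB /= [X in _ - X]exchange_big subrr addr0.
by [].
Qed.

End LeviCivita.

(** * Skew part of the Ricci tensor of a torsion-free connection *)

Section RicciSkewPart.
Context {R : realType} {n : nat} (M : smoothManifold R n).
Variables (Gamma : connection_coefs M) (i : chart_index M).

(** Among the four terms of the Ricci tensor only the derivative of the trace can fail to be
    symmetric: the first and third are symmetric because the connection is torsion-free, the fourth
    by exchanging its summation indices. *)
Lemma ricci_skew_part (x : 'rV[R]_n) :
  (\forall y \near x, forall a b c, Gamma i y a b c = Gamma i y a c b) ->
  (forall v a b c, derivable (fun y => Gamma i y a b c) x v) ->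
  skew_part (ricci Gamma i x) = \matrix_(a, b)
    (2^-1 * (partial a (fun y => \sum_m Gamma i y m b m) x -
             partial b (fun y => \sum_m Gamma i y m a m) x)).
Proof.
move=> Gsym Gder; apply/matrixP => a b; rewrite !mxE; congr (_ * _).
have sum_partial a' b' : \sum_m partial b' (fun y => Gamma i y m a' m) x =
    partial b' (fun y => \sum_m Gamma i y m a' m) x.
  have : is_derive x (basis_vec R b') (fun y => \sum_m Gamma i y m a' m)
    (\sum_m partial b' (fun y => Gamma i y m a' m) x).
    by apply: is_derive_sumf => m; apply: derivableP.
  by case.
have E1 : \sum_m partial m (fun y => Gamma i y m a b) x =
          \sum_m partial m (fun y => Gamma i y m b a) x.
  apply: eq_bigr => m _; apply: near_eq_derive.
  by apply: filterS Gsym => y ->.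
have E2 : \sum_m \sum_s Gamma i x m m s * Gamma i x s a b =
          \sum_m \sum_s Gamma i x m m s * Gamma i x s b a.
  apply: eq_bigr => m _; apply: eq_bigr => s _.
  by rewrite (nbhs_singleton Gsym s a b).
have E3 : \sum_m \sum_s Gamma i x m b s * Gamma i x s a m =
          \sum_m \sum_s Gamma i x m a s * Gamma i x s b m.
  rewrite exchange_big; apply: eq_bigr => m _; apply: eq_bigr => s _.
  by rewrite mulrC.
have comb (p1 p2 p3 p4 q1 q2 q3 q4 t u : R) : p1 = q1 -> p3 = q3 -> p4 = q4 ->
    p2 = t -> q2 = u -> p1 - p2 + p3 - p4 - (q1 - q2 + q3 - q4) = u - t.
  by move=> -> -> -> -> ->; ring.
exact: comb E1 E2 E3 (sum_partial a b) (sum_partial b a).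
Qed.

End RicciSkewPart.

(** * The candidate connection and the curl of its trace *)

Section BerwaldConnection.
Context {R : realType} {n : nat} (M : smoothManifold R n).
Variables (alpha : pseudoMetric M) (beta : oneForm M) (c0 m p : R) (H : M -> R).

Definition raised (i : chart_index M) (x : 'rV[R]_n) (a : 'I_n) : R :=
  \sum_d invmx (alpha i x) a d * beta i x 0 d.

Definition berwald_connection : connection_coefs M := fun i x a b c =>
  levi_civita alpha i x a b c + H (chart_inv i x) *
    (c0 * p * raised i x a * alpha i x b c
     - c0 * p * ((a == b)%:R * beta i x 0 c + (a == c)%:R * beta i x 0 b)
     + m * raised i x a * beta i x 0 b * beta i x 0 c).

Variable i : chart_index M.
Implicit Types (x v : 'rV[R]_n) (a b c d : 'I_n).

Let U := chart_img i.
Let G (y : 'rV[R]_n) := invmx (alpha i y).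
Let h (y : 'rV[R]_n) := H (chart_inv i y).
Let B (y : 'rV[R]_n) a : R := beta i y 0 a.
Let dn (y : 'rV[R]_n) := dual_norm alpha beta i y.

Lemma raised_lower x a : U x -> \sum_b raised i x b * alpha i x a b = B x a.
Proof.
move=> Ux; under eq_bigr do rewrite mulr_suml.
rewrite exchange_big /=.
transitivity (\sum_d (d == a)%:R * B x d).
  apply: eq_bigr => d _; rewrite -(inverse_metric_mul alpha d a Ux) mulr_suml.
  apply: eq_bigr => b _.
  by rewrite (inverse_metric_sym alpha _ _ Ux) (metric_entry_sym alpha _ _ Ux) mulrAC.
rewrite (bigD1 a) //= eqxx mul1r big1 ?addr0 // => d /negPf ->.
by rewrite mul0r.
Qed.

Lemma dual_norm_raised x : dn x = \sum_a raised i x a * B x a.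
Proof.
apply: eq_bigr => a _; rewrite mulr_suml; apply: eq_bigr => d _.
by rewrite mulrAC.
Qed.

Lemma derivable_oneform x v a : U x -> derivable (fun y => B y a) x v.
Proof. by move=> Ux; exact: smooth_derivable (oneform_smooth beta i a) Ux. Qed.

Lemma derivable_raised x v a : U x -> derivable (fun y => raised i y a) x v.
Proof.
move=> Ux; apply: derivable_sumf => d; apply: derivable_mulf.
  exact: derivable_inverse_metric.
exact: derivable_oneform.
Qed.

Lemma derivable_dual_norm x v : U x -> derivable dn x v.
Proof.
move=> Ux; apply: derivable_sumf => a; apply: derivable_sumf => b.
apply: derivable_mulf; last exact: derivable_oneform.
apply: derivable_mulf; last exact: derivable_oneform.
exact: derivable_inverse_metric.
Qed.

(** The two terms with a derivative of beta are equal. The derivative of the inverse metric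
    contributes minus the derivative of the metric contracted with the raised one-form, which
    compatibility turns into the Christoffel terms missing from the covariant derivative. *)
Lemma partial_dual_norm x a : U x ->
  partial a dn x =
  2 * \sum_c raised i x c * cov_deriv (levi_civita alpha) beta i x a c.
Proof.
move=> Ux.
pose dB c := partial a (fun y => B y c) x.
pose dg := \matrix_(c, d) partial a (fun y => alpha i y c d) x.
pose dG := \matrix_(c, d) partial a (fun y => invmx (alpha i y) c d) x.
have EG : dG = - (G x *m dg *m G x).
  apply: derive_invmx => [|c d]; first exact: metric_near_unit.
  exact: derivable_metric.
have : is_derive x (basis_vec R a) dn (\sum_c \sum_d
    ((dG c d * B x c + G x c d * dB c) * B x d + G x c d * B x c * dB d)).
  apply: is_derive_sumf => c; apply: is_derive_sumf => d.
  apply: is_derive_mulf; last by apply: derivableP; exact: derivable_oneform.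
  rewrite mxE; apply: is_derive_mulf; apply: derivableP.
    exact: derivable_inverse_metric.
  exact: derivable_oneform.
case=> _ E; apply: etrans E _.
have EB : \sum_c \sum_d G x c d * dB c * B x d = \sum_c raised i x c * dB c.
  apply: eq_bigr => c _; rewrite mulr_suml; apply: eq_bigr => d _.
  by rewrite mulrAC.
have EB' : \sum_c \sum_d G x c d * B x c * dB d = \sum_c raised i x c * dB c.
  rewrite exchange_big; apply: eq_bigr => d _; rewrite mulr_suml.
  by apply: eq_bigr => c _; rewrite /G (inverse_metric_sym alpha _ _ Ux).
have EdG : \sum_c \sum_d dG c d * B x c * B x d =
    - \sum_k \sum_l raised i x k * raised i x l * dg k l.
  rewrite EG; pose bv := \row_a B x a.
  (* As a product row times matrix times column, the expression can be reassociated so that each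
     [G x] raises one copy of beta. *)
  transitivity ((bv *m - (G x *m dg *m G x) *m bv^T) 0 0).
    rewrite mxE exchange_big; apply: eq_bigr => d _ /=.
    rewrite !mxE mulr_suml; apply: eq_bigr => c _.
    by rewrite [bv 0 c]mxE [_ * B x c]mulrC.
  have -> : bv *m - (G x *m dg *m G x) *m bv^T =
      - ((bv *m G x) *m dg *m (G x *m bv^T)).
    by rewrite mulmxN mulNmx !mulmxA.
  rewrite mxE; congr (- _); rewrite mxE exchange_big /=.
  apply: eq_bigr => l _; rewrite mxE mulr_suml; apply: eq_bigr => k _.
  have -> : (bv *m G x) 0 k = raised i x k.
    rewrite mxE; apply: eq_bigr => d _.
    by rewrite mxE mulrC /G (inverse_metric_sym alpha _ _ Ux).
  have -> : (G x *m bv^T) l 0 = raised i x l.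
    by rewrite mxE; apply: eq_bigr => d _; rewrite !mxE.
  by rewrite mulrAC.
have Edg : \sum_k \sum_l raised i x k * raised i x l * dg k l =
    2 * \sum_c raised i x c * (\sum_d levi_civita alpha i x d a c * B x d).
  transitivity (2 * (2^-1 * \sum_k \sum_l raised i x k * raised i x l *
      partial a (fun y => alpha i y k l) x)).
    rewrite mulrA divff ?pnatr_eq0 // mul1r.
    by apply: eq_bigr => k _; apply: eq_bigr => l _; rewrite mxE.
  rewrite -levi_civita_quadratic //; congr (_ * _); apply: eq_bigr => c _.
  congr (_ * _); apply: eq_bigr => d _; congr (_ * _).
  by rewrite -raised_lower //; apply: eq_bigr => e _; rewrite mulrC.
transitivity (\sum_c \sum_d dG c d * B x c * B x d +
    \sum_c \sum_d G x c d * dB c * B x d + \sum_c \sum_d G x c d * B x c * dB d).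
  rewrite -!big_split /=; apply: eq_bigr => c _.
  by rewrite -!big_split /=; apply: eq_bigr => d _; rewrite mulrDl.
rewrite EB EB' EdG Edg.
transitivity (2 * (\sum_c raised i x c * dB c -
    \sum_c raised i x c * (\sum_d levi_civita alpha i x d a c * B x d))); first by ring.
by rewrite -sumrB; congr (_ * _); apply: eq_bigr => c _; rewrite mulrBr.
Qed.

Hypothesis H_berwald : berwald_condition alpha beta c0 m p H.

(** Contracting the Berwald condition with the raised one-form cancels [p]. What matters later is
    that the differential of the squared norm is a multiple of beta. *)
Lemma berwald_partial_dual_norm x a : U x ->
  partial a dn x = 2 * h x * (c0 + m * dn x) * dn x * B x a.
Proof.
move=> Ux; rewrite partial_dual_norm //.
transitivity (2 * \sum_c (h x * (c0 * (1 - p) + m * dn x) * B x a * (raised i x c * B x c) +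
    h x * (c0 * p * dn x) * (raised i x c * alpha i x a c))).
  congr (_ * _); apply: eq_bigr => c _; rewrite (H_berwald Ux) -/(h x) -/(dn x).
  by rewrite -/(B x a) -/(B x c); ring.
rewrite big_split /= -!mulr_sumr -dual_norm_raised raised_lower //.
by ring.
Qed.

(** The right-hand side of the Berwald condition is symmetric, and antisymmetrizing a torsion-free
    covariant derivative leaves only partial derivatives. *)
Lemma berwald_oneform_closed x a b : U x ->
  partial a (fun y => B y b) x = partial b (fun y => B y a) x.
Proof.
move=> Ux.
have cov_sym : cov_deriv (levi_civita alpha) beta i x a b =
    cov_deriv (levi_civita alpha) beta i x b a.
  by rewrite !(H_berwald Ux) (metric_entry_sym alpha a b Ux); ring.
have Gamma_sym : \sum_d levi_civita alpha i x d a b * B x d =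
    \sum_d levi_civita alpha i x d b a * B x d.
  by apply: eq_bigr => d _; rewrite (levi_civita_sym alpha d a b Ux).
by move: cov_sym; rewrite /cov_deriv Gamma_sym => /addIr.
Qed.

Lemma berwald_connection_sym x a b c : U x ->
  berwald_connection i x a b c = berwald_connection i x a c b.
Proof.
move=> Ux; rewrite /berwald_connection (levi_civita_sym alpha a b c Ux).
by rewrite (metric_entry_sym alpha b c Ux); ring.
Qed.

(** In the trace of [D] the metric term gives [c p] times beta, the two deltas give [- c p (1 + n)]
    times beta, and the last term gives [m] times the squared norm times beta. *)
Lemma berwald_connection_trace x a : U x ->
  \sum_d berwald_connection i x d a d =
  \sum_d levi_civita alpha i x d a d + h x * (m * dn x - n%:R * (c0 * p)) * B x a.
Proof.
move=> Ux; rewrite big_split; congr (_ + _).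
have E1 : \sum_d (d == a)%:R * B x d = B x a.
  rewrite (bigD1 a) //= eqxx mul1r big1 ?addr0 // => d /negPf ->.
  by rewrite mul0r.
have E2 : \sum_(d < n) B x a = n%:R * B x a by rewrite sumr_const card_ord mulr_natl.
transitivity (\sum_d (h x * (c0 * p) * (raised i x d * alpha i x a d) -
    h x * (c0 * p) * ((d == a)%:R * B x d) - h x * (c0 * p) * B x a +
    h x * m * B x a * (raised i x d * B x d))).
  by apply: eq_bigr => d _; rewrite eqxx mul1r -/(h x) -/(B x a) -/(B x d); ring.
rewrite big_split !sumrB /= -!mulr_sumr -dual_norm_raised raised_lower // E1 E2.
by ring.
Qed.

Hypothesis H_smooth : smooth_function H.

Lemma derivable_factor x v : U x -> derivable h x v.
Proof. by move=> Ux; exact: smooth_derivable (H_smooth i) Ux. Qed.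

Lemma derivable_berwald_connection x v a b c : U x ->
  derivable (fun y => berwald_connection i y a b c) x v.
Proof.
move=> Ux; have dB d : derivable (fun y => B y d) x v by exact: derivable_oneform.
have dr : derivable (fun y => raised i y a) x v by exact: derivable_raised.
have dcst (k : R) : derivable (fun _ : 'rV[R]_n => k) x v by exact: derivable_cst.
apply: derivableD; first exact: derivable_levi_civita.
apply: derivable_mulf; first exact: derivable_factor.
apply: derivableD; first apply: derivableB.
- have dg : derivable (fun y => alpha i y b c) x v by exact: derivable_metric.
  exact: (derivable_mulf (derivable_mulf (dcst (c0 * p)) dr) dg).
- apply: (derivable_mulf (dcst (c0 * p))); apply: derivableD.
    exact: (derivable_mulf (dcst _) (dB c)).
  exact: (derivable_mulf (dcst _) (dB b)).
- exact: (derivable_mulf (derivable_mulf (derivable_mulf (dcst m) dr) (dB b)) (dB c)).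
Qed.

Lemma berwald_trace_curl x a b : U x ->
  partial a (fun y => \sum_d berwald_connection i y d b d) x -
  partial b (fun y => \sum_d berwald_connection i y d a d) x =
  (n%:R * (c0 * p) - m * dn x) * (B x a * partial b h x - B x b * partial a h x).
Proof.
move=> Ux; pose T a y := \sum_d levi_civita alpha i y d a d.
(* The [- 0] is the derivative of the constant [n%:R * (c0 * p)]. The trace formula holds only on
   the chart image, hence it is substituted near [x] before differentiating. *)
have hT k l : partial l (fun y => \sum_d berwald_connection i y d k d) x =
    partial l (T k) x +
    ((partial l h x * (m * dn x - n%:R * (c0 * p)) + h x * (m * partial l dn x - 0))
      * B x k + h x * (m * dn x - n%:R * (c0 * p)) * partial l (fun y => B y k) x).
  have -> : partial l (fun y => \sum_d berwald_connection i y d k d) x =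
      partial l (fun y => T k y + h y * (m * dn y - n%:R * (c0 * p)) * B y k) x.
    apply: near_eq_derive; apply: filterS (chart_imgP Ux) => y Uy.
    exact: berwald_connection_trace.
  have : is_derive x (basis_vec R l)
      (fun y => T k y + h y * (m * dn y - n%:R * (c0 * p)) * B y k)
      (partial l (T k) x +
    ((partial l h x * (m * dn x - n%:R * (c0 * p)) + h x * (m * partial l dn x - 0))
      * B x k + h x * (m * dn x - n%:R * (c0 * p)) * partial l (fun y => B y k) x)).
    apply: is_derive_addf.
      apply: derivableP; apply: derivable_sumf => d; exact: derivable_levi_civita.
    apply: is_derive_mulf; last by apply: derivableP; exact: derivable_oneform.
    apply: is_derive_mulf; first by apply: derivableP; exact: derivable_factor.
    apply: is_derive_addf.
      by apply: is_derive_scalef; apply: derivableP; exact: derivable_dual_norm.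
  by case.
(* Here [N] stands for the squared norm, [k] for [n c p], and [q1], [q2] for derivatives of the
   norm. The [q] terms cancel because each [q] is the same multiple of the matching [b]. *)
have comb (P1 P2 t1 t2 h1 h2 q1 q2 b1 b2 e1 e2 N h0 k : R) :
    P1 = t1 + ((h1 * (m * N - k) + h0 * (m * q1 - 0)) * b2 + h0 * (m * N - k) * e1) ->
    P2 = t2 + ((h2 * (m * N - k) + h0 * (m * q2 - 0)) * b1 + h0 * (m * N - k) * e2) ->
    t1 = t2 -> e1 = e2 -> q1 = 2 * h0 * (c0 + m * N) * N * b1 ->
    q2 = 2 * h0 * (c0 + m * N) * N * b2 ->
    P1 - P2 = (k - m * N) * (b1 * h2 - b2 * h1).
  by move=> -> -> -> -> -> ->; ring.
exact: comb (hT b a) (hT a b) (levi_civita_trace_closed alpha b a Ux)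
  (berwald_oneform_closed a b Ux) (berwald_partial_dual_norm a Ux)
  (berwald_partial_dual_norm b Ux).
Qed.

Lemma skew_ricci_berwald_connection x : U x ->
  skew_part (ricci berwald_connection i x) =
  (2^-1 * (n%:R * (c0 * p) - m * dn x)) *: wedge (beta i x) (differential H i x).
Proof.
move=> Ux; rewrite ricci_skew_part; first last.
- by move=> v a b c; exact: derivable_berwald_connection.
- apply: filterS (chart_imgP Ux) => y Uy a b c; exact: berwald_connection_sym.
apply/matrixP => a b; rewrite !mxE -mulrA; congr (_ * _).
exact: berwald_trace_curl.
Qed.

End BerwaldConnection.

(** * Vertical derivatives and the spray on the tangent bundle *)

Section TangentBundleCalculus.
Context {R : realType} {n : nat}.
Notation Z := ('rV[R]_n * 'rV[R]_n)%type.
Implicit Types (z : Z) (F : Z -> R) (W : set Z) (a b c d q : 'I_n).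
Implicit Types (K : 'rV[R]_n -> 'I_n -> 'I_n -> 'I_n -> R).

Lemma is_derive_base (phi : 'rV[R]_n -> R) z (w : Z) (dphi : R) :
  is_derive z.1 w.1 phi dphi -> is_derive z w (fun y : Z => phi y.1) dphi.
Proof.
move=> hd; apply: is_derive_at_line => /=.
by apply: is_derive_line; rewrite scale0r addr0.
Qed.

Lemma is_derive_vel_coord z (w : Z) c : is_derive z w (fun y : Z => y.2 0 c) (w.2 0 c).
Proof.
apply: is_derive_at_line.
have -> : (fun s : R => (z + s *: w).2 0 c) = (fun s : R => z.2 0 c + s * w.2 0 c).
  by apply/funext => s /=; rewrite !mxE.
have := is_derive_addf (is_derive_cstf (z.2 0 c) (0 : R) 1)
  (is_derive_mulf (is_derive_id (0 : R) 1) (is_derive_cstf (w.2 0 c) (0 : R) 1)).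
by rewrite mul1r mulr0 addr0 add0r.
Qed.

Lemma is_derive_vertical (phi : 'rV[R]_n -> R) z (w : 'rV[R]_n) :
  is_derive z ((0, w) : Z) (fun y : Z => phi y.1) 0.
Proof. apply: is_derive_base; exact: is_derive0. Qed.

Lemma partial_vel_quadratic (k : 'rV[R]_n -> 'I_n -> 'I_n -> R) c z :
  partial_vel c (fun y : Z => \sum_b \sum_d k y.1 b d * y.2 0 b * y.2 0 d) z =
  \sum_d (k z.1 c d + k z.1 d c) * z.2 0 d.
Proof.
have : is_derive z ((0, basis_vec R c) : Z)
    (fun y : Z => \sum_b \sum_d k y.1 b d * y.2 0 b * y.2 0 d)
    (\sum_b \sum_d ((0 * z.2 0 b + k z.1 b d * basis_vec R c 0 b) * z.2 0 d +
      k z.1 b d * z.2 0 b * basis_vec R c 0 d)).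
  apply: is_derive_sumf => b; apply: is_derive_sumf => d.
  apply: is_derive_mulf; last exact: is_derive_vel_coord.
  apply: is_derive_mulf; first exact: (is_derive_vertical (fun x => k x b d)).
  exact: is_derive_vel_coord.
case=> _ E; apply: etrans E _.
have delta b : basis_vec R c 0 b = (b == c)%:R by rewrite mxE eqxx.
transitivity (\sum_d \sum_b (k z.1 b d * z.2 0 d * (b == c)%:R) +
    \sum_b \sum_d (k z.1 b d * z.2 0 b * (d == c)%:R)).
  rewrite [X in _ = X + _]exchange_big -big_split; apply: eq_bigr => b _ /=.
  rewrite -big_split; apply: eq_bigr => d _ /=.
  by rewrite !delta; ring.
have pick (f : 'I_n -> R) : \sum_b f b * (b == c)%:R = f c.
  rewrite (bigD1 c) //= eqxx mulr1 big1 ?addr0 // => b /negPf ->.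
  by rewrite mulr0.
rewrite -big_split; apply: eq_bigr => d _ /=.
by rewrite !pick mulrDl.
Qed.

Lemma partial_vel_linear (k : 'rV[R]_n -> 'I_n -> R) c z :
  partial_vel c (fun y : Z => \sum_d k y.1 d * y.2 0 d) z = k z.1 c.
Proof.
have : is_derive z ((0, basis_vec R c) : Z) (fun y : Z => \sum_d k y.1 d * y.2 0 d)
    (\sum_d (0 * z.2 0 d + k z.1 d * basis_vec R c 0 d)).
  apply: is_derive_sumf => d; apply: is_derive_mulf.
    exact: (is_derive_vertical (fun x => k x d)).
  exact: is_derive_vel_coord.
case=> _ E; apply: etrans E _.
rewrite (bigD1 c) //= big1 => [|d dc]; rewrite mxE eqxx /=.
  by rewrite eqxx mul0r mulr1 add0r addr0.
by rewrite (negPf dc) mul0r mulr0 addr0.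
Qed.

Lemma near_eq_partial_vel W F F' c z : open W -> {in W, F =1 F'} -> W z ->
  partial_vel c F z = partial_vel c F' z.
Proof.
move=> oW FF' Wz; apply: near_eq_derive.
apply: filterS (open_nbhs_nbhs (conj oW Wz)) => y Wy.
by apply: FF'; rewrite inE.
Qed.

(** Coefficients depend on the base point only, hence are constant along fibres, and two vertical
    derivatives of the quadratic form recover them. This reads a connection off its spray. *)
Lemma vel_hessian_quadratic K W F a b c z : open W ->
  (forall y, W y ->
     F y = 2^-1 * \sum_b \sum_c K y.1 a b c * y.2 0 b * y.2 0 c) ->
  W z -> K z.1 a b c = K z.1 a c b ->
  partial_vel b (partial_vel c F) z = K z.1 a b c.
Proof.
move=> oW FE Wz Ksym.
pose k (x : 'rV[R]_n) b d := 2^-1 * K x a b d.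
have E1 y : W y -> partial_vel c F y = \sum_d (k y.1 c d + k y.1 d c) * y.2 0 d.
  move=> Wy; rewrite -partial_vel_quadratic; apply: (near_eq_partial_vel _ oW) Wy.
  move=> t; rewrite inE => Wt; rewrite FE // mulr_sumr; apply: eq_bigr => e _.
  by rewrite mulr_sumr; apply: eq_bigr => d _; rewrite !mulrA.
pose l (x : 'rV[R]_n) d := k x c d + k x d c.
transitivity (partial_vel b (fun y : Z => \sum_d l y.1 d * y.2 0 d) z).
  by apply: (near_eq_partial_vel _ oW) Wz => y; rewrite inE; exact: E1.
by rewrite partial_vel_linear /l /k -Ksym; field.
Qed.

(** Differentiating [d_m F = N^b_m vd_b F] along the fibres and contracting with
    [v^m] turns the bracket of the spray into [2 g_qb N^b_m v^m]. *)
Lemma spray_of_horizontal K W F a z : open W -> classC 2 W F ->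
  (forall y, W y -> forall a b c, K y.1 a b c = K y.1 a c b) ->
  (forall y, W y -> L_metric F y \in unitmx) ->
  (forall y, W y -> forall a, partial_pos a F y =
     \sum_b (\sum_c K y.1 b a c * y.2 0 c) * partial_vel b F y) ->
  W z ->
  spray F a z = 2^-1 * \sum_b \sum_c K z.1 a b c * z.2 0 b * z.2 0 c.
Proof.
move=> oW hF Ksym gU hor Wz.
pose N b m := \sum_c K z.1 b m c * z.2 0 c.
pose S b := \sum_m z.2 0 m * N b m.
(* Once the two derivatives are exchanged, the horizontality equation, valid near [z], can be
   differentiated along the fibre. *)
have mixed m q : partial_pos m (partial_vel q F) z =
    \sum_b (K z.1 b m q * partial_vel b F z +
      N b m * partial_vel q (partial_vel b F) z).
  apply: etrans (derive_comm _ _ oW hF Wz) _.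
  have -> : 'D_((0, basis_vec R q) : Z) ('D_((basis_vec R m, 0) : Z) F) z =
      'D_((0, basis_vec R q) : Z)
        (fun y : Z => \sum_b (\sum_c K y.1 b m c * y.2 0 c) * partial_vel b F y) z.
    apply: near_eq_derive.
    by apply: filterS (open_nbhs_nbhs (conj oW Wz)) => y Wy; exact: hor.
  have : is_derive z ((0, basis_vec R q) : Z)
      (fun y : Z => \sum_b (\sum_c K y.1 b m c * y.2 0 c) * partial_vel b F y)
      (\sum_b (K z.1 b m q * partial_vel b F z +
        N b m * partial_vel q (partial_vel b F) z)).
    apply: is_derive_sumf => b; apply: is_derive_mulf.
      rewrite -(partial_vel_linear (fun x c => K x b m c)).
      apply: derivableP; apply: derivable_sumf => c; apply: derivable_mulf.
        by have [] := is_derive_vertical (fun x => K x b m c) z (basis_vec R q).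
      by have [] := is_derive_vel_coord z ((0, basis_vec R q) : Z) c.
    apply: derivableP.
    exact: (classC_derivable (classC_derive ((0, basis_vec R b) : Z) hF) Wz).
  by case.
pose P b := partial_vel b F z.
pose D q b := partial_vel q (partial_vel b F) z.
(* By symmetry of [K] the first sum on the right is the horizontal expression for
   [partial_pos q F z], which the spray subtracts. *)
have hamel q : \sum_m z.2 0 m * \sum_b (K z.1 b m q * P b + N b m * D q b) =
    \sum_b N b q * P b + \sum_b S b * D q b.
  under eq_bigr => m _ do rewrite big_split /= mulrDr !mulr_sumr.
  rewrite big_split /=; congr (_ + _).
    rewrite exchange_big /=; apply: eq_bigr => b _; rewrite mulr_suml.
    by apply: eq_bigr => m _; rewrite (Ksym z Wz b m q) mulrCA mulrA.
  rewrite exchange_big; apply: eq_bigr => b _; rewrite mulr_suml.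
  by apply: eq_bigr => m _; rewrite mulrA.
have E q : \sum_m z.2 0 m * partial_pos m (partial_vel q F) z - partial_pos q F z =
    \sum_b S b * D q b.
  have EA : \sum_m z.2 0 m * partial_pos m (partial_vel q F) z =
      \sum_m z.2 0 m * \sum_b (K z.1 b m q * P b + N b m * D q b).
    by apply: eq_bigr => m _; apply: congr1; exact: mixed.
  apply: etrans (congr2 (fun u w => u - w) (etrans EA (hamel q)) (hor z Wz q)) _.
  by rewrite [X in X - _]addrC addrK.
rewrite /spray.
(* [D] is twice the [L_metric], so the inverse metric leaves [2] times a delta. *)
transitivity (4^-1 * \sum_b (2 * S b) * (a == b)%:R).
  congr (_ * _); under eq_bigr => q _ do rewrite E mulr_sumr.
  rewrite exchange_big; apply: eq_bigr => b _ /=.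
  have /matrixP /(_ a b) := mulVmx (gU z Wz); rewrite !mxE => <-.
  rewrite mulr_sumr; apply: eq_bigr => q _; rewrite [L_metric F z q b]mxE.
  by rewrite -/(D q b); field.
rewrite (bigD1 a) //= eqxx mulr1 big1 ?addr0 => [|b]; last first.
  by rewrite eq_sym => /negPf ->; rewrite mulr0.
have -> : S a = \sum_b \sum_c K z.1 a b c * z.2 0 b * z.2 0 c.
  apply: eq_bigr => b _; rewrite mulr_sumr; apply: eq_bigr => c _.
  by rewrite mulrCA mulrA.
by field.
Qed.

Lemma partial_vel_fiber_zero W F b x v : open W ->
  (forall v, W (x, v) -> F (x, v) = 0) -> W (x, v) -> partial_vel b F (x, v) = 0.
Proof.
move=> oW F0 Wv; pose e : Z := (0, basis_vec R b).
have lineW : \forall s \near (0 : R), W ((x, v) + s *: e).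
  have hc : (fun s : R => (x, v) + s *: e) @ (0 : R) --> ((x, v) : Z).
    rewrite -[X in _ --> X](_ : (x, v) + (0 : R) *: e = _); last first.
      by rewrite scale0r addr0.
    apply: cvgD; first exact: cvg_cst.
    by apply: cvgZr_tmp; exact: cvg_id.
  exact: (hc _ (open_nbhs_nbhs (conj oW Wv))).
have : is_derive ((x, v) : Z) e F 0.
  apply: is_derive_at_line.
  apply: near_eq_is_derive (is_derive_cstf 0 _ _).
  apply: filterS lineW => s.
  have -> : (x, v) + s *: e = (x, v + s *: basis_vec R b) :> Z.
    by rewrite /e; congr pair => /=; rewrite scaler0 addr0.
  by move=> Ws; rewrite F0.
by case.
Qed.

End TangentBundleCalculus.

(** * Points where the Lagrangian does not vanish, and its square as an exponential *)

(** A function vanishing on the whole part of the fibre in [W] would have zero vertical Hessian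
    there. The dimension is [n.+1] because the zero matrix of size 0 is invertible. *)
Lemma fiber_nonzero {R : realType} {n : nat}
    (F : 'rV[R]_n.+1 * 'rV[R]_n.+1 -> R) (W : set ('rV[R]_n.+1 * 'rV[R]_n.+1)) x v :
  open W -> W (x, v) -> L_metric F (x, v) \in unitmx ->
  exists2 v', W (x, v') & F (x, v') != 0.
Proof.
move=> oW Wv gU; apply: contrapT => hN.
have F0 v' : W (x, v') -> F (x, v') = 0.
  by move=> Wv'; apply: contrapT => /eqP F0; apply: hN; exists v'.
move: gU; have -> : L_metric F (x, v) = 0.
  apply/matrixP => a b; rewrite !mxE (partial_vel_fiber_zero _ oW) ?mulr0 //.
  by move=> v' Wv'; exact: partial_vel_fiber_zero oW F0 Wv'.
by rewrite unitmxE det0 unitr0.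
Qed.

(** Squaring makes the two branches of [real_power] agree. *)
Lemma real_power_square {R : realType} (y r u : R) : real_power y r u -> u != 0 ->
  u * u = expR (r * ln (y * y)) /\ (y != 0 \/ r = 0).
Proof.
have ln_sq (x : R) : 0 < x -> ln (x * x) = ln x + ln x.
  by move=> x0; rewrite lnM ?posrE.
case=> [[y0 ->] _|[k [-> ky ->]] u0].
  have yn0 : y != 0 by rewrite gt_eqF.
  split; last by left.
  by rewrite /powR (negPf yn0) -expRD -mulrDr ln_sq.
(* At [y = 0] a nonzero integer power forces exponent 0, and then the default value of [ln 0] is
   multiplied by 0. *)
have [y0|yn0] := eqVneq y 0.
  case: ky => [|k0]; first by rewrite y0 eqxx.
  have k00 : k = 0.
    apply: contraNeq u0 => kn0; rewrite y0 exp0rz (negPf kn0); exact: eqxx.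
  by rewrite k00 /= mul0r expR0 expr0z mulr1; split => //; right.
split; last by left.
have yy0 : 0 < y * y by rewrite -expr2 exprn_even_gt0.
have := @powR_intmul R (y * y) k (ltW yy0).
by rewrite /powR gt_eqF // => ->; exact/esym/expfzMl.
Qed.

(** With [s = b^2 / A] and [c + m s = Q / A], the exponents of [A^2] in the square add up to
    [1 + p - (p + 1) = 0], so only [b] and [Q] remain. The disjunctions ensure that a logarithm of 0
    occurs only with coefficient 0. *)
Lemma lagrangian_square {R : realType} (c0 m p A b u w : R) :
  A != 0 -> real_power (b ^+ 2 / A) (- p) u ->
  real_power (c0 + m * (b ^+ 2 / A)) (p + 1) w -> A * u * w != 0 ->
  let Q := c0 * A + m * (b * b) in
  [/\ (A * u * w) * (A * u * w) =
        expR ((- 2 * p) * ln (b * b) + (p + 1) * ln (Q * Q)),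
      b != 0 \/ - 2 * p = 0 & Q != 0 \/ p + 1 = 0].
Proof.
move=> A0 hu hw; rewrite !mulf_eq0 !negb_or -andbA => /and3P[_ u0 w0] Q.
have [Eu su] := real_power_square hu u0.
have [Ew sw] := real_power_square hw w0.
set s := b ^+ 2 / A in Eu su Ew sw.
have sq_gt0 (x : R) : x != 0 -> 0 < x * x by move=> x0; rewrite -expr2 exprn_even_gt0.
have yQ : c0 + m * s = Q / A by rewrite /s /Q; field.
have cu : b != 0 \/ p = 0.
  case: su => [s0|/eqP]; last by rewrite oppr_eq0 => /eqP; right.
  by left; apply: contraNneq s0 => b0; rewrite /s b0 expr0n mul0r.
have cw : Q != 0 \/ p + 1 = 0.
  case: sw => [y0|]; last by right.
  by left; apply: contraNneq y0 => Q0; rewrite yQ Q0 mul0r.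
split=> //; last by case: cu => [|->]; [left|right; rewrite mulr0].
have Eu' : u * u = expR (- p * (2 * ln (b * b) - ln (A * A))).
  rewrite Eu; case: cu => [b0|->]; last by rewrite oppr0 !mul0r.
  have -> : s * s = (b * b) * (b * b) / (A * A) by rewrite /s; field.
  rewrite ln_div ?posrE ?sq_gt0 ?mulf_neq0 // lnM ?posrE ?sq_gt0 //.
  by congr expR; ring.
have Ew' : w * w = expR ((p + 1) * (ln (Q * Q) - ln (A * A))).
  rewrite Ew; case: cw => [Q0|->]; last by rewrite !mul0r.
  have -> : (c0 + m * s) * (c0 + m * s) = (Q * Q) / (A * A) by rewrite yQ; field.
  by rewrite ln_div ?posrE ?sq_gt0.
have EA : A * A = expR (ln (A * A)) by rewrite lnK // posrE sq_gt0.
transitivity ((A * A) * (u * u) * (w * w)); first by ring.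
by rewrite Eu' Ew' {1}EA -!expRD; congr expR; ring.
Qed.

(** With [f z = 0] allowed when [r = 0], despite the junk value of [ln 0]. *)
Lemma is_derive_log_square {R : realType} {V : normedModType R} (f : V -> R) z v (r k : R) :
  f z != 0 \/ r = 0 -> is_derive z v f (k * f z) ->
  is_derive z v (fun y => r * ln (f y * f y)) (r * (2 * k)).
Proof.
move=> [f0|->] hf; last first.
  rewrite mul0r (_ : (fun y => _) = fun=> 0); first exact: is_derive_cstf.
  by apply/funext => y; rewrite mul0r.
apply: is_derive_scalef.
have ff0 : 0 < f z * f z by rewrite -expr2 exprn_even_gt0.
have := is_derive_compf (is_derive_mulf hf hf) (is_derive1_ln ff0).
by rewrite (_ : (f z * f z)^-1 * _ = 2 * k) //; field.
Qed.

(** * The Lagrangian is constant along horizontal directions *)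

Section HorizontalLagrangian.
Context {R : realType} {n : nat} (M : smoothManifold R n.+1).
Variables (alpha : pseudoMetric M) (beta : oneForm M) (c0 m p : R) (H : M -> R).
Variables (L : finslerSpacetime M).
Hypothesis L_form : has_lagrangian alpha beta c0 m p L.
Hypothesis H_berwald : berwald_condition alpha beta c0 m p H.
Variable i : chart_index M.
Notation Z := ('rV[R]_n.+1 * 'rV[R]_n.+1)%type.
Implicit Types (x : 'rV[R]_n.+1) (z : Z) (a b c d : 'I_n.+1).

Let U := chart_img i.
Let K := berwald_connection alpha beta c0 m p H i.
Let h (y : 'rV[R]_n.+1) : R := H (chart_inv i y).
Let B (y : 'rV[R]_n.+1) a : R := beta i y 0 a.
Let low z a := \sum_d alpha i z.1 a d * z.2 0 d.
Let A z := metric_eval alpha i z.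
Let Bv z := oneform_eval beta i z.
Let N z a b := \sum_c K z.1 b a c * z.2 0 c.

(** The horizontal lift of the coordinate field [a] for the nonlinear connection of [K]; in
    [N z a b] the upper index is [b]. *)
Definition horizontal_dir z a : Z := (basis_vec R a, \row_b - N z a b).

Lemma oneform_evalE z : \sum_c B z.1 c * z.2 0 c = Bv z.
Proof. by []. Qed.

(** Stated for an arbitrary covector [q], to be used with beta and with the lowered velocity. *)
Lemma berwald_connection_contract z a (q : 'I_n.+1 -> R) :
  \sum_b q b * N z a b =
  \sum_b q b * \sum_c levi_civita alpha i z.1 b a c * z.2 0 c +
  h z.1 * (c0 * p * (\sum_b raised alpha beta i z.1 b * q b) * low z a
    - c0 * p * (q a * Bv z + B z.1 a * \sum_b q b * z.2 0 b)
    + m * (\sum_b raised alpha beta i z.1 b * q b) * B z.1 a * Bv z).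
Proof.
pose r b := raised alpha beta i z.1 b.
have pick_l (f : 'I_n.+1 -> R) b : \sum_c (b == c)%:R * f c = f b.
  rewrite (bigD1 b) //= eqxx mul1r big1 ?addr0 // => d.
  by rewrite eq_sym => /negPf ->; rewrite mul0r.
have EN b : N z a b = \sum_c levi_civita alpha i z.1 b a c * z.2 0 c +
    h z.1 * (c0 * p * r b * low z a - c0 * p * ((a == b)%:R * Bv z + B z.1 a * z.2 0 b)
      + m * r b * B z.1 a * Bv z).
  transitivity (\sum_c (levi_civita alpha i z.1 b a c * z.2 0 c +
      (h z.1 * (c0 * p * r b) * (alpha i z.1 a c * z.2 0 c) -
       h z.1 * (c0 * p * (a == b)%:R) * (B z.1 c * z.2 0 c) -
       h z.1 * (c0 * p * B z.1 a) * ((b == c)%:R * z.2 0 c) +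
       h z.1 * (m * r b * B z.1 a) * (B z.1 c * z.2 0 c)))).
    apply: eq_bigr => c _; rewrite /K /berwald_connection -/(h z.1) -/(r b).
    by rewrite -/(B z.1 c) -/(B z.1 a) [b == a]eq_sym; ring.
  rewrite big_split /=; congr (_ + _).
  rewrite big_split !sumrB /= -!mulr_sumr pick_l -/(low z a).
  by rewrite oneform_evalE; ring.
transitivity (\sum_b (q b * (\sum_c levi_civita alpha i z.1 b a c * z.2 0 c) +
    (h z.1 * (c0 * p * low z a) * (r b * q b) -
     h z.1 * (c0 * p * Bv z) * ((a == b)%:R * q b) -
     h z.1 * (c0 * p * B z.1 a) * (q b * z.2 0 b) +
     h z.1 * (m * B z.1 a * Bv z) * (r b * q b)))).
  by apply: eq_bigr => b _; rewrite EN; ring.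
rewrite big_split /=; congr (_ + _).
rewrite big_split !sumrB /= -!mulr_sumr pick_l.
by rewrite /r; ring.
Qed.

(** The Levi-Civita part of the lift completes the partial derivative of beta to the covariant one.
    The Berwald condition applies, and its terms in the squared norm cancel against those of [D]. *)
Lemma horizontal_derive_oneform z a : U z.1 ->
  is_derive z (horizontal_dir z a) Bv (h z.1 * c0 * (1 + p) * B z.1 a * Bv z).
Proof.
move=> Uz.
pose dB c := partial a (fun y => B y c) z.1.
have hd : is_derive z (horizontal_dir z a) Bv
    (\sum_c (dB c * z.2 0 c + B z.1 c * - N z a c)).
  apply: is_derive_sumf => c; apply: is_derive_mulf.
    apply: (is_derive_base (phi := fun y => B y c)); apply: derivableP.
    exact: derivable_oneform.
  have := is_derive_vel_coord z (horizontal_dir z a) c.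
  by rewrite [X in is_derive _ _ _ X]mxE.
apply: is_derive_eq hd _.
pose cov c := cov_deriv (levi_civita alpha) beta i z.1 a c.
have Ecov : \sum_c dB c * z.2 0 c = \sum_c cov c * z.2 0 c +
    \sum_b B z.1 b * \sum_c levi_civita alpha i z.1 b a c * z.2 0 c.
  have -> : \sum_b B z.1 b * (\sum_c levi_civita alpha i z.1 b a c * z.2 0 c) =
      \sum_c (\sum_b levi_civita alpha i z.1 b a c * B z.1 b) * z.2 0 c.
    under eq_bigr do rewrite mulr_sumr.
    rewrite exchange_big; apply: eq_bigr => c _; rewrite mulr_suml.
    by apply: eq_bigr => b _; ring.
  rewrite -big_split; apply: eq_bigr => c _ /=.
  by rewrite -mulrDl /cov /cov_deriv subrK.
have EH : \sum_c cov c * z.2 0 c =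
    h z.1 * ((c0 * (1 - p) + m * dual_norm alpha beta i z.1) * B z.1 a * Bv z +
      c0 * p * dual_norm alpha beta i z.1 * low z a).
  rewrite -oneform_evalE /low; set dn := dual_norm _ _ _ _.
  rewrite [_ * \sum_c B _ _ * _]mulr_sumr [_ * \sum_d alpha _ _ _ _ * _]mulr_sumr.
  rewrite -big_split mulr_sumr.
  apply: eq_bigr => c _ /=.
  by rewrite /cov (H_berwald Uz) -/(h z.1) -/(B z.1 a) -/(B z.1 c) -/dn; ring.
rewrite big_split /= Ecov EH.
under [X in _ + X = _]eq_bigr do rewrite mulrN.
rewrite sumrN berwald_connection_contract -(dual_norm_raised alpha beta i z.1).
by rewrite oneform_evalE; ring.
Qed.

(** The Levi-Civita part cancels the derivative of the metric; only [D], contracted with the lowered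
    velocity, remains. *)
Lemma horizontal_derive_metric z a : U z.1 ->
  is_derive z (horizontal_dir z a) A
    (- 2 * h z.1 * B z.1 a * (m * (Bv z * Bv z) - c0 * p * A z)).
Proof.
move=> Uz.
pose dg c d := partial a (fun y => alpha i y c d) z.1.
have hv c : is_derive z (horizontal_dir z a) (fun y : Z => y.2 0 c) (- N z a c).
  have := is_derive_vel_coord z (horizontal_dir z a) c.
  by rewrite [X in is_derive _ _ _ X]mxE.
have hd : is_derive z (horizontal_dir z a) A
    (\sum_c \sum_d ((dg c d * z.2 0 c + alpha i z.1 c d * - N z a c) * z.2 0 d +
       alpha i z.1 c d * z.2 0 c * - N z a d)).
  apply: is_derive_sumf => c; apply: is_derive_sumf => d.
  have hg : is_derive z (horizontal_dir z a) (fun y : Z => alpha i y.1 c d) (dg c d).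
    apply: (is_derive_base (phi := fun y => alpha i y c d)); apply: derivableP.
    exact: derivable_metric.
  exact: is_derive_mulf (is_derive_mulf hg (hv c)) (hv d).
apply: is_derive_eq hd _.
pose S := \sum_c \sum_d z.2 0 c * z.2 0 d * dg c d.
transitivity (S - 2 * \sum_b low z b * N z a b).
  transitivity (S + (- \sum_c \sum_d alpha i z.1 c d * z.2 0 d * N z a c -
      \sum_c \sum_d alpha i z.1 d c * z.2 0 d * N z a c)).
    rewrite addrA [X in _ - X]exchange_big /= -!sumrB.
    apply: eq_bigr => c _; rewrite -!sumrB.
    by apply: eq_bigr => d _ /=; ring.
  have -> : \sum_c \sum_d alpha i z.1 d c * z.2 0 d * N z a c =
      \sum_b low z b * N z a b.
    apply: eq_bigr => c _; rewrite mulr_suml; apply: eq_bigr => d _.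
    by rewrite (metric_entry_sym alpha d c Uz).
  have -> : \sum_c \sum_d alpha i z.1 c d * z.2 0 d * N z a c =
      \sum_b low z b * N z a b.
    by apply: eq_bigr => c _; rewrite mulr_suml.
  by ring.
rewrite berwald_connection_contract.
have -> : \sum_b low z b * (\sum_c levi_civita alpha i z.1 b a c * z.2 0 c) =
    2^-1 * S.
  rewrite -(levi_civita_quadratic alpha a (fun c => z.2 0 c) Uz).
  under [RHS]eq_bigr do rewrite mulr_sumr.
  rewrite exchange_big; apply: eq_bigr => b _; rewrite mulr_sumr.
  by apply: eq_bigr => c _ /=; rewrite -/(low z b); ring.
have -> : \sum_b raised alpha beta i z.1 b * low z b = Bv z.
  under eq_bigr do rewrite mulr_sumr.
  rewrite exchange_big; apply: eq_bigr => d _ /=.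
  rewrite -(raised_lower alpha beta d Uz) mulr_suml; apply: eq_bigr => b _.
  by rewrite (metric_entry_sym alpha d b Uz) mulrA.
have -> : \sum_b low z b * z.2 0 b = A z.
  apply: eq_bigr => b _; rewrite mulr_suml; apply: eq_bigr => d _.
  by rewrite mulrAC.
by field.
Qed.

Lemma horizontal_derive_lagrangian z a : lag_dom L i z -> L i z != 0 ->
  'D_(horizontal_dir z a) (L i) z = 0.
Proof.
move=> Dz Lz.
have [[[subU _] _] oD _ _ _] := lag_dom_conic L.
have Uz : U z.1 by exact: subU Dz.
pose Q y := c0 * A y + m * (Bv y * Bv y).
pose E y := - 2 * p * ln (Bv y * Bv y) + (p + 1) * ln (Q y * Q y).
have square y : lag_dom L i y -> L i y != 0 ->
    [/\ L i y * L i y = expR (E y), Bv y != 0 \/ - 2 * p = 0 & Q y != 0 \/ p + 1 = 0].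
  move=> Dy Ly; have [A0 [u [w [hu hw EL]]]] := L_form Dy.
  by rewrite EL; apply: lagrangian_square => //; rewrite -EL.
have [_ sB sQ] := square z Dz Lz.
(* With this factor the logarithmic derivatives of [Bv] and [Q] are [(1 + p) k] and [2 p k], and the
   weights [- 2 p] and [p + 1] in [E] make them cancel. *)
pose k := h z.1 * c0 * B z.1 a.
have dB : is_derive z (horizontal_dir z a) Bv ((1 + p) * k * Bv z).
  by apply: is_derive_eq (horizontal_derive_oneform a Uz) _; rewrite /k; ring.
have dQ : is_derive z (horizontal_dir z a) Q (2 * p * k * Q z).
  have := is_derive_addf (is_derive_scalef c0 (horizontal_derive_metric a Uz))
    (is_derive_scalef m (is_derive_mulf dB dB)).
  by move=> hQ; apply: is_derive_eq hQ _; rewrite /k /Q; ring.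
have dE : is_derive z (horizontal_dir z a) E 0.
  have := is_derive_addf (is_derive_log_square sB dB) (is_derive_log_square sQ dQ).
  by move=> hE; apply: is_derive_eq hE _; ring.
have dexpE : is_derive z (horizontal_dir z a) (fun y => expR (E y)) 0.
  have := is_derive_compf dE (is_derive_expR (E z)).
  by rewrite mulr0.
have dL : is_derive z (horizontal_dir z a) (L i) ('D_(horizontal_dir z a) (L i) z).
  by apply: derivableP; exact: smooth_derivable (lag_smooth L i) Dz.
have cL : {for z, continuous (L i)} by exact: classC_continuous (lag_smooth L i 0) Dz.
(* The exponential formula is available where [L] is nonzero, which by continuity is a neighbourhood
   of [z]. The derivative of the square then yields that of [L], since [L i z] is nonzero. *)
have [_ E0] : is_derive z (horizontal_dir z a) (fun y => L i y * L i y) 0.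
  apply: near_eq_is_derive dexpE.
  apply: filterS (filterI (open_nbhs_nbhs (conj (oD i) Dz)) (cvgr_neq0 _ cL Lz)) => y [Dy Ly].
  by have [-> _ _] := square y Dy Ly.
have [_] := is_derive_mulf dL dL; rewrite E0 [_ * L i z]mulrC -mulrDl => /esym/eqP.
by rewrite mulf_eq0 => /orP[|/eqP //]; rewrite -mulr2n mulrn_eq0 (negPf Lz).
Qed.

(** Linearity of the derivative in the direction splits the horizontal lift into its position and
    velocity parts. *)
Lemma lagrangian_horizontal z a : lag_dom L i z -> L i z != 0 ->
  partial_pos a (L i) z = \sum_b N z a b * partial_vel b (L i) z.
Proof.
move=> Dz Lz; have [_ oD _ _ _] := lag_dom_conic L.
have := horizontal_derive_lagrangian a Dz Lz.
have -> : horizontal_dir z a = ((basis_vec R a, 0) : Z) +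
    \sum_b (- N z a b) *: ((0, basis_vec R b) : Z).
  rewrite /horizontal_dir.
  have -> : \sum_b (- N z a b) *: ((0, basis_vec R b) : Z) =
      (0, \sum_b (- N z a b) *: basis_vec R b) :> Z.
    elim/big_ind2 : _ => // [x1 y1 x2 y2 -> ->|b _].
      by congr pair; rewrite addr0.
    by congr pair; rewrite scaler0.
  congr pair; rewrite ?addr0 //= add0r [LHS]row_sum_delta.
  by apply: eq_bigr => b _; rewrite mxE.
rewrite (derive_sum_dir _ _ _ (oD i) (lag_smooth L i 1%N) Dz) => /eqP.
rewrite addr_eq0 => /eqP E; apply: etrans E _; rewrite -sumrN; apply: eq_bigr => b _.
by rewrite mulNr opprK.
Qed.

(** The formula for [L] may degenerate where [L = 0]; points with [L <> 0] in
    each fibre suffice, since the fibre Hessian of the spray there determines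
    [Gamma]. *)
Lemma affine_connection_berwald (Gamma : connection_coefs M) x a b c :
  affine_connection_of L Gamma -> U x -> Gamma i x a b c = K x a b c.
Proof.
move=> L_Gamma Ux; have [[[subU _] _] oD _ fiber _] := lag_dom_conic L.
have [v0 Dv0] := fiber i x Ux.
have [v Dv Lv] := fiber_nonzero (oD i) Dv0 (lag_nondegenerate Dv0).
pose W : set Z := lag_dom L i `&` [set z | L i z != 0].
have oW : open W.
  rewrite openE => z [Dz Lz]; apply: filterI.
    exact: open_nbhs_nbhs (conj (oD i) Dz).
  have cL : {for z, continuous (L i)} by exact: classC_continuous (lag_smooth L i 0) Dz.
  exact: cvgr_neq0 cL Lz.
have Ksym z b' c' a' : W z -> K z.1 a' b' c' = K z.1 a' c' b'.
  by case=> /subU Uz _; exact: berwald_connection_sym.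
(* [Gamma] is the fibre Hessian of the spray, and on [W] the spray is the quadratic form of [K]. *)
have [_ ->] := L_Gamma i (x, v) Dv.
apply: (vel_hessian_quadratic oW); [|by []|exact: Ksym].
move=> z Wz; apply: (spray_of_horizontal _ oW) Wz.
- by apply: classC_sub (lag_smooth L i 2) => y [].
- by move=> y Wy a' b' c'; exact: Ksym.
- by move=> y [/lag_nondegenerate].
- by move=> y [Dy Ly] a'; exact: lagrangian_horizontal.
Qed.

End HorizontalLagrangian.

(** * Locality of the Ricci tensor and the metrizable case *)

Section RicciCongruence.
Context {R : realType} {n : nat} (M : smoothManifold R n).

(** Agreement near [x] is required because the Ricci tensor contains first derivatives of the
    coefficients. *)
Lemma ricci_near_eq (Gamma Gamma' : connection_coefs M) i (x : 'rV[R]_n) :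
  (\forall y \near x, forall a b c, Gamma i y a b c = Gamma' i y a b c) ->
  ricci Gamma i x = ricci Gamma' i x.
Proof.
move=> E; have Ex := nbhs_singleton E.
have dE k a b c : partial k (fun y => Gamma i y a b c) x =
    partial k (fun y => Gamma' i y a b c) x.
  by apply: near_eq_derive; apply: filterS E => y ->.
apply/matrixP => a b; rewrite !mxE; congr (_ - _ + _ - _).
- by apply: eq_bigr => k _; exact: dE.
- by apply: eq_bigr => k _; exact: dE.
- by apply: eq_bigr => k _; apply: eq_bigr => s _; rewrite !Ex.
- by apply: eq_bigr => k _; apply: eq_bigr => s _; rewrite !Ex.
Qed.

Lemma skew_ricci_levi_civita (g : pseudoMetric M) i (x : 'rV[R]_n) :
  chart_img i x -> skew_part (ricci (levi_civita g) i x) = 0.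
Proof.
move=> Ux; rewrite ricci_skew_part.
- apply/matrixP => a b; rewrite !mxE (levi_civita_trace_closed g a b Ux).
  by rewrite subrr mulr0.
- by apply: filterS (chart_imgP Ux) => y Uy a b c; exact: levi_civita_sym.
- by move=> v a b c; exact: derivable_levi_civita.
Qed.

End RicciCongruence.

Theorem proposition1 (R : realType) (M : smoothManifold R 4)
  (alpha : pseudoMetric M) (beta : oneForm M) (c m p : R)
  (L : finslerSpacetime M) (Gamma : connection_coefs M) (H : M -> R)
  (L_form : has_lagrangian alpha beta c m p L)
  (L_berwald : affine_connection_of L Gamma)
  (H_smooth : smooth_function H)
  (H_berwald : berwald_condition alpha beta c m p H) :
  let f i x := 2^-1 * (4 * c * p - m * dual_norm alpha beta i x) in
  (forall i x, chart_img i x ->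
     skew_part (ricci Gamma i x) =
       f i x *: wedge (beta i x) (differential H i x)) /\
  ((exists i x, [/\ chart_img i x, f i x != 0
                  & wedge (beta i x) (differential H i x) != 0]) ->
   ~ metrizable Gamma).
Proof.
move=> f.
have skew i x : chart_img i x -> skew_part (ricci Gamma i x) =
    f i x *: wedge (beta i x) (differential H i x).
  move=> Ux; rewrite (@ricci_near_eq _ _ _ _ (berwald_connection alpha beta c m p H)).
    by rewrite (skew_ricci_berwald_connection H_berwald H_smooth Ux) /f mulrA.
  apply: filterS (chart_imgP Ux) => y Uy a b d.
  exact: (affine_connection_berwald L_form H_berwald).
(* A metric with connection [Gamma] would make the skew part vanish at [x], where it is a nonzero
   scalar times a nonzero matrix. *)
split=> // -[i [x [Ux f0 w0]]] [g Eg].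
have := skew i x Ux.
rewrite (@ricci_near_eq _ _ _ _ (levi_civita g)) ?skew_ricci_levi_civita //.
  move=> /esym/eqP; rewrite scaler_eq0 (negPf f0) (negPf w0); by [].
by apply: filterS (chart_imgP Ux) => y Uy a b d; rewrite Eg.
Qed.
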